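(* Let $s\ge1$ be an integer and let $r=2s-1$. There is a constant $c(r)>0$, depending only on $r$, such that for each $n\ge1$ there exist a collection $Y_s$ and a function $F\in C^r\cap\Delta^{(1)}(Y_s)$ such that $$E_n^{(1)}(F,Y_s)>\sqrt[3]{n}\,\frac{c(r)}{n^r}\,\omega_4\left(F^{(r)},\frac1n\right).$$ Hence, for every $A>0$ and $N>0$, there exist $n>N$, a collection $Y_s$ and a function $F\in C^r\cap\Delta^{(1)}(Y_s)$ such that $$E_n^{(1)}(F,Y_s)>\frac A{n^r}\,\omega_4\left(F^{(r)},\frac1n\right).$$
   Context: $C=C^0$ is the space of $2\pi$-periodic continuous functions $f:\mathbb R\to\mathbb R$ with the norm $\|f\|=\max_{x\in\mathbb R}|f(x)|$; for $r\in\mathbb N$, $C^r$ is the subspace of $r$ times continuously differentiable functions in $C$. A collection $Y_s=\{y_i\}_{i\in\mathbb Z}$, $s\in\mathbb N$, consists of real points with $y_i<y_{i+1}$ and $y_{i+2s}=y_i+2\pi$ for all $i\in\mathbb Z$. $\Delta^{(1)}(Y_s)$ is the set of $f\in C$ such that $(-1)^{i-1}f$ is nondecreasing on $[y_{i-1},y_i]$ for every $i\in\mathbb Z$. For $f\in\Delta^{(1)}(Y_s)$ and $n\ge1$, $E_n^{(1)}(f,Y_s)=\inf\|f-T_n\|$, the infimum being over all trigonometric polynomials $T_n$ of degree $<n$ that belong to $\Delta^{(1)}(Y_s)$. For $g\in C$ and $k\ge1$, $\omega_k(g,t)=\sup_{0<h\le t}\|\Delta_h^k(g,\cdot)\|$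 is the $k$th modulus of smoothness, where $\Delta_h^k(g,x)=\sum_{i=0}^k(-1)^i\binom ki g(x+ih)$. *)

(* Defs.v *)
From Stdlib Require Import Reals ZArith.
From Coquelicot Require Import Coquelicot.
Open Scope R_scope.

Definition Cper (f : R -> R) : Prop :=
  (forall x, continuous f x) /\ (forall x, f (x + 2 * PI) = f x).

(* For f in [Cper] the set is bounded and the supremum is attained, so this is
   max |f|; the projection [real] only matters for unbounded f, where it
   returns 0. The same remark applies to [modulus] and [En1] below. *)
Definition supnorm (f : R -> R) : R :=
  real (Lub_Rbar (fun v => exists x, v = Rabs (f x))).

(* [ex_derive_n f k x] by itself only says that the (k-1)-st iterate of the
   total operator [Derive] is differentiable, hence the quantification over
   all k <= r. *)
Definition Crper (r : nat) (f : R -> R) : Prop :=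
  Cper f /\
  (forall k x, (k <= r)%nat -> ex_derive_n f k x) /\
  (forall x, continuous (Derive_n f r) x).

Definition collection (s : nat) (Y : Z -> R) : Prop :=
  (forall i : Z, Y i < Y (i + 1)%Z) /\
  (forall i : Z, Y (i + 2 * Z.of_nat s)%Z = Y i + 2 * PI).

Definition Delta1 (Y : Z -> R) (f : R -> R) : Prop :=
  Cper f /\
  forall (i : Z) (x y : R), Y (i - 1)%Z <= x -> x <= y -> y <= Y i ->
    powerRZ (-1) (i - 1) * f x <= powerRZ (-1) (i - 1) * f y.

Definition trig_poly_lt (n : nat) (T : R -> R) : Prop :=
  exists (m : nat) (a b : nat -> R), (m < n)%nat /\
    forall x, T x =
      sum_f_R0 (fun j => a j * cos (INR j * x) + b j * sin (INR j * x)) m.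

Definition En1 (n : nat) (f : R -> R) (Y : Z -> R) : R :=
  real (Glb_Rbar (fun e => exists T : R -> R,
    trig_poly_lt n T /\ Delta1 Y T /\ e = supnorm (fun x => f x - T x))).

(* [Binomial.C] is qualified because Coquelicot's [C] is the type of complex
   numbers. *)
Definition fdiff (k : nat) (h : R) (g : R -> R) (x : R) : R :=
  sum_f_R0 (fun i => (-1) ^ i * Binomial.C k i * g (x + INR i * h)) k.

Definition modulus (k : nat) (g : R -> R) (t : R) : R :=
  real (Lub_Rbar (fun w => exists h, 0 < h <= t /\ w = supnorm (fdiff k h g))).

(* Main.v *)
Require Import Defs.
From Stdlib Require Import Reals ZArith Lra Lia.
From Coquelicot Require Import Coquelicot.
Open Scope R_scope.

(** Put v = sin(x/2), w = cos(x/2) and P = v^(2s+1) (v - b w^3), with b of order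
    n^(-4/3).  Near 0 the function P behaves like x^(2s+2) - b x^(2s+1) up to
    scaling, so it decreases on an interval of length about b to the right of 0
    before it increases to pi and decreases on [pi, 2 pi].  Let F be P with this
    dip erased by a cutoff at scale b ([flattened]).  Then F is zero on a short
    interval [0, b'], increases on [0, pi] and decreases on [pi, 2 pi], so it lies
    in Delta1 for a collection with one point at pi and the other 2s-1 points in
    (0, d), however small d is.

    F is smooth in the sense of the fourth modulus: P is a trigonometric
    polynomial of fixed degree with bounded derivatives, which contributes n^(-4),
    and the derivative of order 2s-1 of F - P is of order b^(2s+2) / b^(2s-1) = b^3,
    that is n^(-4) as well ([flattened_estimates]).

    F is hard to approximate: if T is comonotone of degree < n, then by Rolle's
    theorem T', ..., T^(2s-1) have zeros in (0, d), that is, T is almost constant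
    to order 2s-1 at 0.  So T - T(0) is about a x^(2s) - b x^(2s+1) + x^(2s+2), and
    T can only increase to the right of 0 if a is at least of order b^2.  But P has
    no term x^(2s), so a is controlled by the derivative of order 2s of T - P,
    which Bernstein's inequality bounds by n^(2s) times the norm of T - P.  Hence
    the error is at least of order b^2 n^(-2s) ([comonotone_error_lower_bound]),
    that is n^(1/3) n^(-r) n^(-4).

    Bernstein's inequality is needed only up to a constant; it follows from
    writing the derivative as a convolution with a modulated Fejer kernel
    ([bernstein]). *)

(** * Trigonometric sums in the half angle and Bernstein's inequality *)

(** Half-integer frequencies are allowed because the extremal function is a
    product of an even number of factors sin(x/2), cos(x/2), each of which alone
    is only 4 pi-periodic.  Writing the terms as phase-shifted cosines makes the
    class visibly closed under derivatives, translations and multiplication by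
    cos(x/2 + psi), with no bookkeeping of coefficients. *)
Inductive half_trig (N : nat) : (R -> R) -> Prop :=
| half_trig_cos j phi : (j <= N)%nat ->
    half_trig N (fun x => cos (INR j * (x / 2) + phi))
| half_trig_lin a f b g : half_trig N f -> half_trig N g ->
    half_trig N (fun x => a * f x + b * g x)
| half_trig_ext f g : half_trig N f -> (forall x, f x = g x) -> half_trig N g.

Lemma half_trig_le N M f : (N <= M)%nat -> half_trig N f -> half_trig M f.
Proof.
  intros HNM Hf; induction Hf.
  - apply half_trig_cos; lia.
  - now apply half_trig_lin.
  - now apply half_trig_ext with f.
Qed.

Lemma half_trig_const N c : half_trig N (fun _ => c).
Proof.
  apply half_trig_ext with (fun x => c * cos (INR 0 * (x / 2) + 0)
                                     + 0 * cos (INR 0 * (x / 2) + 0)).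
  - apply half_trig_lin; apply half_trig_cos; lia.
  - intros x; simpl; rewrite Rmult_0_l, Rplus_0_l, cos_0; ring.
Qed.

Lemma half_trig_scal N a f : half_trig N f -> half_trig N (fun x => a * f x).
Proof.
  intros Hf; apply half_trig_ext with (fun x => a * f x + 0 * f x).
  - now apply half_trig_lin.
  - intros x; ring.
Qed.

Lemma half_trig_plus N f g :
  half_trig N f -> half_trig N g -> half_trig N (fun x => f x + g x).
Proof.
  intros Hf Hg; apply half_trig_ext with (fun x => 1 * f x + 1 * g x).
  - now apply half_trig_lin.
  - intros x; ring.
Qed.

Lemma half_trig_minus N f g :
  half_trig N f -> half_trig N g -> half_trig N (fun x => f x - g x).
Proof.
  intros Hf Hg; apply half_trig_ext with (fun x => 1 * f x + (-1) * g x).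
  - now apply half_trig_lin.
  - intros x; ring.
Qed.

Lemma half_trig_mul_cos N f psi :
  half_trig N f -> half_trig (S N) (fun x => f x * cos (x / 2 + psi)).
Proof.
  intros Hf; induction Hf.
  - destruct j as [|j].
    + apply half_trig_ext with (fun x => cos phi * cos (INR 1 * (x / 2) + psi)).
      * apply half_trig_scal, half_trig_cos; lia.
      * intros x; simpl; now rewrite Rmult_0_l, Rplus_0_l, Rmult_1_l.
    + apply half_trig_ext with
        (fun x => / 2 * cos (INR (S (S j)) * (x / 2) + (phi + psi))
                + / 2 * cos (INR j * (x / 2) + (phi - psi))).
      * apply half_trig_lin; apply half_trig_cos; lia.
      * intros x; rewrite !S_INR.
        replace ((INR j + 1 + 1) * (x / 2) + (phi + psi))
          with (((INR j + 1) * (x / 2) + phi) + (x / 2 + psi)) by ring.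
        replace (INR j * (x / 2) + (phi - psi))
          with (((INR j + 1) * (x / 2) + phi) - (x / 2 + psi)) by ring.
        rewrite cos_plus, cos_minus; field.
  - apply half_trig_ext with
      (fun x => a * (f x * cos (x / 2 + psi)) + b * (g x * cos (x / 2 + psi))).
    + now apply half_trig_lin.
    + intros x; ring.
  - apply half_trig_ext with (fun x => f x * cos (x / 2 + psi)); auto.
    intros x; now rewrite H.
Qed.

Lemma half_trig_mul_sin N f :
  half_trig N f -> half_trig (S N) (fun x => f x * sin (x / 2)).
Proof.
  intros Hf; apply half_trig_ext with (fun x => f x * cos (x / 2 + (- (PI / 2)))).
  - now apply half_trig_mul_cos.
  - intros x; rewrite cos_plus, cos_neg, sin_neg, cos_PI2, sin_PI2; ring.
Qed.

Lemma half_trig_shift N h f : half_trig N f -> half_trig N (fun x => f (x + h)).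
Proof.
  intros Hf; induction Hf.
  - apply half_trig_ext with
      (fun x => cos (INR j * (x / 2) + (INR j * (h / 2) + phi))).
    + now apply half_trig_cos.
    + intros x; f_equal; field.
  - now apply half_trig_lin with (f := fun x => f (x + h)) (g := fun x => g (x + h)).
  - apply half_trig_ext with (fun x => f (x + h)); auto.
Qed.

Lemma half_trig_bounded N f :
  half_trig N f -> exists M, forall x, Rabs (f x) <= M.
Proof.
  intros Hf; induction Hf as [j phi Hj|a f b g _ [A HA] _ [B HB]|f g _ [A HA] He].
  - exists 1; intros x; apply Rabs_le; apply COS_bound.
  - exists (Rabs a * A + Rabs b * B); intros x.
    eapply Rle_trans; [apply Rabs_triang|]; rewrite !Rabs_mult.
    apply Rplus_le_compat; apply Rmult_le_compat_l; auto using Rabs_pos.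
  - exists A; intros x; now rewrite <- He.
Qed.

(** ** Fejer's kernel *)

Lemma is_RInt_sum (g : nat -> R -> R) (I : nat -> R) a b N :
  (forall p, (p <= N)%nat -> is_RInt (g p) a b (I p)) ->
  is_RInt (fun t => sum_f_R0 (fun p => g p t) N) a b (sum_f_R0 I N).
Proof.
  induction N as [|N IH]; intros H; simpl.
  - apply H; lia.
  - apply (is_RInt_plus (V := R_NormedModule)).
    + apply IH; intros; apply H; lia.
    + apply H; lia.
Qed.

Lemma is_RInt_sin_period c (k : Z) : k <> 0%Z ->
  is_RInt (fun t => sin (c + IZR k * (t / 2))) 0 (4 * PI) 0.
Proof.
  intros Hk.
  assert (Hk' : IZR k <> 0) by (now apply not_0_IZR).
  set (G := fun t => - (2 / IZR k) * cos (c + IZR k * (t / 2))).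
  replace 0 with (minus (G (4 * PI)) (G 0)) at 2.
  - apply (is_RInt_derive G (fun t => sin (c + IZR k * (t / 2)))).
    + intros x _; unfold G; auto_derive; auto; unfold Rdiv; field; auto.
    + intros x _; apply (ex_derive_continuous (fun t => sin (c + IZR k * (t / 2)))).
      auto_derive; auto.
  - unfold G, minus, plus, opp; simpl.
    replace (c + IZR k * (4 * PI / 2)) with (c + 2 * IZR k * PI) by field.
    replace (c + IZR k * (0 / 2)) with c by field.
    enough (cos (c + 2 * IZR k * PI) = cos c) as -> by ring.
    rewrite cos_plus.
    replace (2 * IZR k * PI) with (2 * (IZR k * PI)) by ring.
    rewrite cos_2a_sin, sin_2a.
    rewrite (sin_eq_0_1 (IZR k * PI)) by (now exists k).
    ring.
Qed.

Lemma is_RInt_sin_period_iff c (k : Z) :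
  is_RInt (fun t => sin (c + IZR k * (t / 2))) 0 (4 * PI)
    (if Z.eq_dec k 0 then 4 * PI * sin c else 0).
Proof.
  destruct (Z.eq_dec k 0) as [->|Hk]; [|now apply is_RInt_sin_period].
  apply (is_RInt_ext (fun _ => sin c)).
  - intros t _; f_equal; ring.
  - replace (4 * PI * sin c) with (scal (4 * PI - 0) (sin c)).
    + apply (is_RInt_const (V := R_NormedModule)).
    + unfold scal; simpl; unfold mult; simpl; ring.
Qed.


Lemma sum_mult_sum (a b : nat -> R) N M :
  sum_f_R0 a N * sum_f_R0 b M
  = sum_f_R0 (fun p => sum_f_R0 (fun q => a p * b q) M) N.
Proof.
  rewrite Rmult_comm, scal_sum; apply sum_eq; intros p _.
  rewrite scal_sum; apply sum_eq; intros; ring.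
Qed.

Definition double_sum (N : nat) (F : nat -> nat -> R) : R :=
  sum_f_R0 (fun p => sum_f_R0 (fun q => F p q) N) N.

Lemma double_sum_ext N F G :
  (forall p q, (p <= N)%nat -> (q <= N)%nat -> F p q = G p q) ->
  double_sum N F = double_sum N G.
Proof. intros H; do 2 (apply sum_eq; intros); auto. Qed.

Lemma double_sum_lin N a F b G :
  double_sum N (fun p q => a * F p q + b * G p q)
  = a * double_sum N F + b * double_sum N G.
Proof.
  unfold double_sum; rewrite !scal_sum, <- sum_plus; apply sum_eq; intros p _.
  rewrite sum_plus, (Rmult_comm _ a), (Rmult_comm _ b), !scal_sum.
  f_equal; apply sum_eq; intros; ring.
Qed.

Definition fejer (N : nat) (t : R) : R :=
  sum_f_R0 (fun p => cos (INR p * (t / 2))) N ^ 2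
  + sum_f_R0 (fun p => sin (INR p * (t / 2))) N ^ 2.

(** The square of a sum of exponentials: expanding it turns sin m times the
    kernel into a sum of sines, because the terms with cos m cancel in pairs
    (p, q), (q, p). *)
Lemma fejer_double_sum N m t :
  sin m * fejer N t
  = double_sum N (fun p q => sin (m + (INR p - INR q) * (t / 2))).
Proof.
  set (c := fun p : nat => cos (INR p * (t / 2))).
  set (d := fun p : nat => sin (INR p * (t / 2))).
  transitivity (double_sum N (fun p q =>
     sin m * (1 * (c p * c q) + 1 * (d p * d q))
     + cos m * (1 * (d p * c q) + (-1) * (c p * d q)))).
  - rewrite !double_sum_lin; unfold double_sum; rewrite <- !sum_mult_sum.
    unfold fejer; fold c d; ring.
  - apply double_sum_ext; intros p q _ _; unfold c, d.
    rewrite Rmult_minus_distr_r, sin_plus, sin_minus, cos_minus; ring.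
Qed.

Lemma is_RInt_double_sum N (g : nat -> nat -> R -> R) (I : nat -> nat -> R) a b :
  (forall p q, (p <= N)%nat -> (q <= N)%nat -> is_RInt (g p q) a b (I p q)) ->
  is_RInt (fun t => double_sum N (fun p q => g p q t)) a b (double_sum N I).
Proof.
  intros H; apply (is_RInt_sum (fun p t => sum_f_R0 (fun q => g p q t) N)).
  intros p Hp; apply (is_RInt_sum (g p)); auto.
Qed.

Lemma sum_indicator N k c : (0 <= k <= Z.of_nat N)%Z ->
  sum_f_R0 (fun q => if Z.eq_dec (Z.of_nat q) k then c else 0) N = c.
Proof.
  revert k; induction N as [|N IH]; intros k Hk; cbn [sum_f_R0].
  - destruct Z.eq_dec; [easy|lia].
  - destruct (Z.eq_dec k (Z.of_nat (S N))) as [->|Hne].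
    + destruct Z.eq_dec as [_|]; [|lia].
      enough (sum_f_R0 (fun q => if Z.eq_dec (Z.of_nat q) (Z.of_nat (S N)) then c else 0) N
              = 0) by lra.
      transitivity (sum_f_R0 (fun _ => 0) N).
      * apply sum_eq; intros i Hi; destruct Z.eq_dec; [lia|easy].
      * rewrite sum_cte; ring.
    + rewrite IH by lia; destruct Z.eq_dec; [lia|ring].
Qed.

Lemma sum_indicator_out N k c : (k < 0 \/ Z.of_nat N < k)%Z ->
  sum_f_R0 (fun q => if Z.eq_dec (Z.of_nat q) k then c else 0) N = 0.
Proof.
  intros Hk; transitivity (sum_f_R0 (fun _ => 0) N).
  - apply sum_eq; intros i Hi; destruct Z.eq_dec; [lia|easy].
  - rewrite sum_cte; ring.
Qed.

Lemma sum_below N j c : (j <= S N)%nat ->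
  sum_f_R0 (fun p => if Nat.ltb p j then c else 0) N = INR j * c.
Proof.
  revert j; induction N as [|N IH]; intros j Hj; cbn [sum_f_R0].
  - destruct j as [|[|j]]; simpl; try lra; lia.
  - destruct (Nat.eq_dec j (S (S N))) as [->|Hne].
    + replace (S N <? S (S N))%nat with true by (symmetry; apply Nat.ltb_lt; lia).
      transitivity (sum_f_R0 (fun p => if (p <? S N)%nat then c else 0) N + c).
      * f_equal; apply sum_eq; intros i Hi.
        replace (i <? S (S N))%nat with true by (symmetry; apply Nat.ltb_lt; lia).
        replace (i <? S N)%nat with true by (symmetry; apply Nat.ltb_lt; lia). easy.
      * rewrite IH by lia; rewrite (S_INR (S N)); ring.
    + rewrite IH by lia.
      replace (S N <? j)%nat with false by (symmetry; apply Nat.ltb_ge; lia). ring.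
Qed.

(** For 1 <= j <= N+1 exactly j pairs (p, q) in [0, N]^2 satisfy
    N + 1 + p - q = j; this count is what makes the kernel below reproduce the
    factor j of the derivative. *)
Lemma double_sum_diag N j c : (j <= S N)%nat ->
  double_sum N (fun p q =>
    if Z.eq_dec (Z.of_nat N + 1 + Z.of_nat p - Z.of_nat q - Z.of_nat j) 0
    then c else 0) = INR j * c.
Proof.
  intros Hj; rewrite <- (sum_below N j c Hj); apply sum_eq; intros p Hp.
  transitivity (sum_f_R0 (fun q => if Z.eq_dec (Z.of_nat q)
     (Z.of_nat N + 1 + Z.of_nat p - Z.of_nat j) then c else 0) N).
  - apply sum_eq; intros q _; do 2 destruct Z.eq_dec; easy || lia.
  - destruct (Nat.ltb_spec p j).
    + apply sum_indicator; lia.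
    + apply sum_indicator_out; lia.
Qed.

Lemma fejer_pos N t : 0 <= fejer N t.
Proof. unfold fejer; nra. Qed.

Lemma is_RInt_fejer N : is_RInt (fejer N) 0 (4 * PI) (4 * PI * (INR N + 1)).
Proof.
  apply (is_RInt_ext (fun t => double_sum N (fun p q =>
     sin (PI / 2 + IZR (Z.of_nat p - Z.of_nat q) * (t / 2))))).
  - intros t _; rewrite <- (Rmult_1_l (fejer N t)), <- sin_PI2, fejer_double_sum.
    apply double_sum_ext; intros p q _ _.
    now rewrite minus_IZR, <- !INR_IZR_INZ.
  - replace (4 * PI * (INR N + 1)) with (double_sum N (fun p q =>
      if Z.eq_dec (Z.of_nat p - Z.of_nat q) 0 then 4 * PI * sin (PI / 2) else 0)).
    + apply is_RInt_double_sum; intros; apply is_RInt_sin_period_iff.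
    + rewrite sin_PI2, <- S_INR.
      replace (4 * PI * INR (S N)) with (INR (S N) * (4 * PI * 1)) by ring.
      rewrite <- (double_sum_diag N (S N) _ (le_n _)).
      apply double_sum_ext; intros; do 2 destruct Z.eq_dec; easy || lia.
Qed.

(** Fejer's kernel modulated to the frequency N+1: its sine coefficient of
    order j is j for 0 <= j <= N, so that convolution with it differentiates
    every sum of order N. *)
Definition bernstein_kernel (N : nat) (t : R) : R :=
  sin ((INR N + 1) * (t / 2)) * fejer N t.

Lemma bernstein_kernel_abs N t : Rabs (bernstein_kernel N t) <= fejer N t.
Proof.
  unfold bernstein_kernel; rewrite Rabs_mult, (Rabs_pos_eq (fejer N t));
    [|apply fejer_pos].
  rewrite <- (Rmult_1_l (fejer N t)) at 2.
  apply Rmult_le_compat_r; [apply fejer_pos|].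
  apply Rabs_le, SIN_bound.
Qed.

(** Differentiation is averaging over a period against the modulated kernel.
    Both sides are linear in f, so the single cosines suffice; for them the
    integral is computed by orthogonality and [double_sum_diag]. *)
Lemma half_trig_derivative N f : half_trig N f ->
  exists f', half_trig N f' /\ forall x, is_derive f x (f' x) /\
    is_RInt (fun t => f (x + t) * bernstein_kernel N t) 0 (4 * PI) (4 * PI * f' x).
Proof.
  intros Hf; induction Hf as [j phi Hj|a f b g _ [f' [Hf' HDf]] _ [g' [Hg' HDg]]
                             |f g _ [f' [Hf' HDf]] He].
  - exists (fun x => (INR j / 2) * cos (INR j * (x / 2) + (phi + PI / 2))); split.
    { now apply half_trig_scal, half_trig_cos. }
    intros x; split.
    { auto_derive; auto; unfold Rdiv. rewrite <- Rplus_assoc, cos_plus.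
      fold (PI / 2); rewrite cos_PI2, sin_PI2; field. }
    set (y := INR j * (x / 2) + phi).
    apply (is_RInt_ext (fun t => double_sum N (fun p q =>
       / 2 * sin (y + IZR (Z.of_nat N + 1 + Z.of_nat p - Z.of_nat q + Z.of_nat j) * (t / 2))
       + / 2 * sin (- y + IZR (Z.of_nat N + 1 + Z.of_nat p - Z.of_nat q - Z.of_nat j) * (t / 2))))).
    + intros t _; unfold bernstein_kernel; rewrite fejer_double_sum.
      replace (INR j * ((x + t) / 2) + phi) with (y + INR j * (t / 2))
        by (unfold y; field).
      rewrite <- (Rplus_0_r (cos _ * _)), <- (Rmult_0_l (double_sum N (fun _ _ => 0))) at 1.
      rewrite <- double_sum_lin.
      apply double_sum_ext; intros p q _ _.
      rewrite !minus_IZR, !plus_IZR, !minus_IZR, !plus_IZR, <- !INR_IZR_INZ.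
      set (z := (INR N + 1) * (t / 2) + (INR p - INR q) * (t / 2)).
      replace (y + (INR N + 1 + INR p - INR q + INR j) * (t / 2))
        with (z + (y + INR j * (t / 2))) by (unfold z; ring).
      replace (- y + (INR N + 1 + INR p - INR q - INR j) * (t / 2))
        with (z - (y + INR j * (t / 2))) by (unfold z; ring).
      rewrite sin_plus, sin_minus; field.
    + replace (4 * PI * (INR j / 2 * cos (INR j * (x / 2) + (phi + PI / 2))))
        with (double_sum N (fun p q =>
          / 2 * (if Z.eq_dec (Z.of_nat N + 1 + Z.of_nat p - Z.of_nat q + Z.of_nat j) 0
                 then 4 * PI * sin y else 0)
        + / 2 * (if Z.eq_dec (Z.of_nat N + 1 + Z.of_nat p - Z.of_nat q - Z.of_nat j) 0
                 then 4 * PI * sin (- y) else 0))).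
      * apply is_RInt_double_sum; intros p q Hp Hq.
        apply (is_RInt_plus (V := R_NormedModule));
          apply (is_RInt_scal (V := R_NormedModule)); apply is_RInt_sin_period_iff.
      * rewrite double_sum_lin, double_sum_diag by lia.
        rewrite (double_sum_ext N _ (fun _ _ => 0 * 0 + 0 * 0)).
        2: { intros p q Hp Hq; destruct Z.eq_dec; [lia|ring]. }
        rewrite (double_sum_lin N 0 (fun _ _ => 0) 0 (fun _ _ => 0)).
        rewrite <- Rplus_assoc; fold y; rewrite cos_plus, cos_PI2, sin_PI2, sin_neg.
        field.
  - exists (fun x => a * f' x + b * g' x); split; [now apply half_trig_lin|].
    intros x; destruct (HDf x) as [D1 I1], (HDg x) as [D2 I2]; split.
    + apply (is_derive_plus (fun x => a * f x) (fun x => b * g x));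
        apply is_derive_scal; auto.
    + replace (4 * PI * (a * f' x + b * g' x))
        with (a * (4 * PI * f' x) + b * (4 * PI * g' x)) by ring.
      apply (is_RInt_ext (fun t => a * (f (x + t) * bernstein_kernel N t)
                                 + b * (g (x + t) * bernstein_kernel N t))).
      { intros t _; simpl; match goal with |- ?u = ?v => change (@eq R u v) end; ring. }
      apply (is_RInt_plus (V := R_NormedModule));
          apply (is_RInt_scal (V := R_NormedModule)); auto.
  - exists f'; split; auto; intros x; destruct (HDf x) as [D1 I1]; split.
    + now apply (is_derive_ext f).
    + apply (is_RInt_ext (fun t => f (x + t) * bernstein_kernel N t)); auto.
      intros t _; now rewrite He.
Qed.

Lemma half_trig_is_derive N f x : half_trig N f -> is_derive f x (Derive f x).
Proof.
  intros Hf; destruct (half_trig_derivative N f Hf) as [f' [_ H]].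
  apply Derive_correct; exists (f' x); apply H.
Qed.

Lemma half_trig_Derive N f : half_trig N f -> half_trig N (Derive f).
Proof.
  intros Hf; destruct (half_trig_derivative N f Hf) as [f' [Hf' H]].
  apply half_trig_ext with f'; auto.
  intros x; symmetry; apply is_derive_unique, H.
Qed.

(** The modulated kernel is dominated by Fejer's kernel, whose mean is N+1. *)
Lemma bernstein N f M : half_trig N f -> (forall x, Rabs (f x) <= M) ->
  forall x, Rabs (Derive f x) <= (INR N + 1) * M.
Proof.
  intros Hf HM x; destruct (half_trig_derivative N f Hf) as [f' [_ H]].
  destruct (H x) as [D I]; rewrite (is_derive_unique _ _ _ D).
  assert (HP := PI_RGT_0).
  assert (IF : is_RInt (fun t => M * fejer N t) 0 (4 * PI)
                 (M * (4 * PI * (INR N + 1)))).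
  { apply (is_RInt_scal (V := R_NormedModule)), is_RInt_fejer. }
  assert (Hle : forall t, Rabs (f (x + t) * bernstein_kernel N t) <= M * fejer N t).
  { intros t; rewrite Rabs_mult; apply Rmult_le_compat; auto using Rabs_pos.
    apply bernstein_kernel_abs. }
  assert (Hu : 4 * PI * f' x <= M * (4 * PI * (INR N + 1))).
  { eapply is_RInt_le; [|exact I|exact IF|]; [lra|].
    intros t _; eapply Rle_trans; [apply Rle_abs|apply Hle]. }
  assert (Hl : - (4 * PI * f' x) <= M * (4 * PI * (INR N + 1))).
  { eapply is_RInt_le; [|exact (is_RInt_opp _ _ _ _ I)|exact IF|]; [lra|].
    intros t _; eapply Rle_trans; [|apply (Hle t)].
    unfold opp; simpl; rewrite <- Rabs_Ropp; apply Rle_abs. }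
  apply Rabs_le; split; nra.
Qed.

Lemma half_trig_Derive_n N f k : half_trig N f -> half_trig N (Derive_n f k).
Proof.
  intros Hf; induction k as [|k IH]; simpl; auto; now apply half_trig_Derive.
Qed.

Lemma bernstein_n N f M k : half_trig N f -> (forall x, Rabs (f x) <= M) ->
  forall x, Rabs (Derive_n f k x) <= (INR N + 1) ^ k * M.
Proof.
  intros Hf HM; induction k as [|k IH]; intros x; simpl.
  - rewrite Rmult_1_l; auto.
  - rewrite Rmult_assoc; apply bernstein; auto; now apply half_trig_Derive_n.
Qed.

Lemma half_trig_is_derive_n N f k x : half_trig N f ->
  is_derive (Derive_n f k) x (Derive_n f (S k) x).
Proof. intros Hf; apply (half_trig_is_derive N), half_trig_Derive_n, Hf. Qed.

(** * Finite differences, zeros and orders of vanishing *)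

Lemma lipschitz_of_derive_bound (f f' : R -> R) M x y :
  (forall t, is_derive f t (f' t)) ->
  (forall t, Rmin x y <= t <= Rmax x y -> Rabs (f' t) <= M) ->
  Rabs (f y - f x) <= M * Rabs (y - x).
Proof.
  intros Hd HM.
  destruct (MVT_abs f f' x y) as [c [-> Hc]].
  - intros c _; now apply is_derive_Reals.
  - apply Rmult_le_compat_r; auto using Rabs_pos.
Qed.

Lemma Derive_n_diff_step N p h k x : half_trig N p ->
  Derive_n (fun y => p y - p (y + h)) k x = Derive_n p k x - Derive_n p k (x + h).
Proof.
  intros Hp; revert x; induction k as [|k IH]; intros x; [easy|].
  change (Derive (Derive_n (fun y => p y - p (y + h)) k) x
          = Derive_n p (S k) x - Derive_n p (S k) (x + h)).
  rewrite (Derive_ext _ _ _ IH); apply is_derive_unique.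
  apply (is_derive_minus (Derive_n p k) (fun y => Derive_n p k (y + h))).
  - now apply half_trig_is_derive_n with N.
  - replace (Derive_n p (S k) (x + h)) with (scal 1 (Derive_n p (S k) (x + h)))
      by (unfold scal; simpl; unfold mult; simpl; ring).
    apply (is_derive_comp (Derive_n p k) (fun y => y + h)).
    + now apply half_trig_is_derive_n with N.
    + auto_derive; auto.
Qed.

(** The step is applied to the function before recursing, so that an induction
    can feed bounds for the derivatives of g - g(. + h) to the next step. *)
Fixpoint iter_diff (k : nat) (h : R) (g : R -> R) (x : R) : R :=
  match k with
  | O => g x
  | S k => iter_diff k h (fun y => g y - g (y + h)) x
  end.

Lemma iter_diff_half_trig N p k h M x : half_trig N p -> 0 < h ->
  (forall y, Rabs (Derive_n p k y) <= M) -> Rabs (iter_diff k h p x) <= h ^ k * M.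
Proof.
  revert p M; induction k as [|k IH]; intros p M Hp Hh HM.
  - simpl; rewrite Rmult_1_l; apply HM.
  - simpl iter_diff; replace (h ^ S k * M) with (h ^ k * (M * h)) by (simpl; ring).
    apply IH; auto.
    { apply half_trig_minus, half_trig_shift; auto. }
    intros y; rewrite (Derive_n_diff_step N) by auto.
    rewrite Rabs_minus_sym.
    replace h with (Rabs (y + h - y)) at 2
      by (replace (y + h - y) with h by ring; apply Rabs_pos_eq; lra).
    apply lipschitz_of_derive_bound with (Derive_n p (S k)); auto.
    intros t; now apply half_trig_is_derive_n with N.
Qed.

Lemma fdiff4_iter_diff h g x : fdiff 4 h g x = iter_diff 4 h g x.
Proof.
  unfold fdiff, iter_diff, Binomial.C; simpl sum_f_R0.
  simpl fact; simpl Nat.sub; simpl INR.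
  rewrite !Rmult_0_l, !Rmult_1_l.
  replace (x + (1 + 1) * h) with (x + h + h) by ring.
  replace (x + (1 + 1 + 1) * h) with (x + h + h + h) by ring.
  replace (x + (1 + 1 + 1 + 1) * h) with (x + h + h + h + h) by ring.
  rewrite Rplus_0_r; simpl fact; simpl INR; field.
Qed.

Lemma iter_diff_bounded k h g M x :
  (forall y, Rabs (g y) <= M) -> Rabs (iter_diff k h g x) <= 2 ^ k * M.
Proof.
  revert g M; induction k as [|k IH]; intros g M HM; simpl iter_diff.
  - simpl; rewrite Rmult_1_l; auto.
  - replace (2 ^ S k * M) with (2 ^ k * (2 * M)) by (simpl; ring).
    apply IH; intros y; eapply Rle_trans; [apply Rabs_triang|].
    rewrite Rabs_Ropp; generalize (HM y), (HM (y + h)); lra.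
Qed.

Lemma iter_diff_plus k h f g x :
  iter_diff k h (fun y => f y + g y) x = iter_diff k h f x + iter_diff k h g x.
Proof.
  revert f g; induction k as [|k IH]; intros f g; simpl; auto.
  rewrite <- IH; clear IH.
  assert (E : forall k u v x, (forall y, u y = v y) -> iter_diff k h u x = iter_diff k h v x).
  { clear; induction k as [|k IH]; intros u v x H; simpl; auto.
    apply IH; intros y; now rewrite !H. }
  apply E; intros y; ring.
Qed.

(** The zeros are listed from left to right, each one opening the interval in
    which the next is sought; this is the form in which Rolle's theorem passes
    from a function to its derivative by induction. *)
Fixpoint has_zeros (m : nat) (g : R -> R) (a b : R) : Prop :=
  match m with
  | O => True
  | S m => exists y, a < y <= b /\ g y = 0 /\ has_zeros m g y b
  end.

Lemma has_zeros_weaken m g a a' b : a' <= a -> has_zeros m g a b -> has_zeros m g a' b.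
Proof.
  destruct m as [|m]; simpl; auto; intros Ha [y [Hy H]]; exists y; split; [lra|auto].
Qed.

(** Rolle's theorem between consecutive zeros. *)
Lemma has_zeros_derive m g g' y b : (forall x, is_derive g x (g' x)) ->
  g y = 0 -> has_zeros m g y b -> has_zeros m g' y b.
Proof.
  intros Hd; revert y; induction m as [|m IH]; intros y Hy; simpl; auto.
  intros [y1 [Hy1 [E1 H]]].
  destruct (MVT_cor2 g g' y y1) as [z [Ez Hz]]; [lra| |].
  { intros c _; now apply is_derive_Reals. }
  exists z; split; [lra|]; split.
  - rewrite Hy, E1 in Ez; assert (y1 - y <> 0) by lra.
    apply (Rmult_eq_reg_r (y1 - y)); auto; lra.
  - apply has_zeros_weaken with y1; [lra|auto].
Qed.

Lemma has_zeros_derive_n N g m k a b : half_trig N g -> (k < m)%nat ->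
  has_zeros m g a b -> exists z, a < z <= b /\ Derive_n g k z = 0.
Proof.
  intros Hg Hk Hz.
  enough (H : has_zeros (S (m - k - 1)) (Derive_n g k) a b).
  { destruct H as [z [Hz1 [Hz2 _]]]; eauto. }
  revert Hk; induction k as [|k IH]; intros Hk.
  - now replace (S (m - 0 - 1)) with m by lia.
  - destruct IH as [y [Hy [E H]]]; [lia|].
    apply has_zeros_weaken with y; [lra|].
    apply has_zeros_derive with (Derive_n g k); auto.
    + intros x; now apply half_trig_is_derive_n with N.
    + now replace (S (m - S k - 1)) with (m - k - 1)%nat by lia.
Qed.

Lemma Derive_n_S_inner f j x : Derive_n f (S j) x = Derive_n (Derive f) j x.
Proof.
  change (Derive f) with (Derive_n f 1); rewrite Derive_n_comp.
  now replace (j + 1)%nat with (S j) by lia.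
Qed.

Lemma half_trig_sin_pow N g k : half_trig N g ->
  half_trig (k + N) (fun x => sin (x / 2) ^ k * g x).
Proof.
  intros Hg; induction k as [|k IH]; simpl.
  - apply half_trig_ext with g; auto; intros; ring.
  - apply half_trig_ext with (fun x => sin (x / 2) ^ k * g x * sin (x / 2)).
    + now apply half_trig_mul_sin.
    + intros; ring.
Qed.

(** Each differentiation lowers the exponent of sin(x/2) by one and leaves a
    cofactor in the same class. *)
Lemma Derive_n_sin_pow_0 N g k j : half_trig N g -> (j < k)%nat ->
  Derive_n (fun x => sin (x / 2) ^ k * g x) j 0 = 0.
Proof.
  revert N g k; induction j as [|j IH]; intros N g k Hg Hj.
  - simpl; replace (0 / 2) with 0 by field; rewrite sin_0, pow_i by lia; ring.
  - destruct k as [|k]; [lia|].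
    rewrite Derive_n_S_inner.
    rewrite (Derive_n_ext _ (fun x => sin (x / 2) ^ k *
      (INR (S k) / 2 * (g x * cos (x / 2 + 0)) + 1 * (Derive g x * sin (x / 2))))).
    + apply IH with (S N); [|lia].
      apply half_trig_lin.
      * now apply half_trig_mul_cos.
      * now apply half_trig_mul_sin, half_trig_Derive.
    + intros x; apply is_derive_unique; rewrite Rplus_0_r.
      assert (Hdg := half_trig_is_derive N g x Hg).
      assert (ex_derive g x) by (now exists (Derive g x)).
      auto_derive; auto.
      change (fun x0 : R => g x0) with g.
      replace (match k with 0%nat => 1 | S _ => INR k + 1 end) with (INR (S k))
        by (destruct k; simpl; lra).
      unfold Rdiv; ring.
Qed.

(** * Regularity of truncated powers and smooth steps *)

Lemma is_derive_constant (c x : R) : is_derive (fun _ : R => c) x 0.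
Proof. auto_derive; auto. Qed.

(** The derivative is quantified existentially rather than written with
    [Derive], so the product, quotient and chain rules are plain inductions. *)
Fixpoint C_reg (k : nat) (f : R -> R) : Prop :=
  match k with
  | O => forall x, continuous f x
  | S k => exists f', (forall x, is_derive f x (f' x)) /\ C_reg k f'
  end.

Lemma C_reg_continuous k f x : C_reg k f -> continuous f x.
Proof.
  destruct k as [|k]; simpl; auto.
  intros [f' [H _]]; apply (ex_derive_continuous f); now exists (f' x).
Qed.

Lemma C_reg_pred k f : C_reg (S k) f -> C_reg k f.
Proof.
  revert f; induction k as [|k IH]; intros f [f' [Hd Hf']].
  - intros x; apply (ex_derive_continuous f); now exists (f' x).
  - exists f'; auto.
Qed.

Lemma C_reg_ext k f g : (forall x, f x = g x) -> C_reg k f -> C_reg k g.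
Proof.
  destruct k as [|k]; simpl; intros He H.
  - intros x; apply continuous_ext with f; auto.
  - destruct H as [f' [Hd H]]; exists f'; split; auto.
    intros x; apply is_derive_ext with f; auto.
Qed.

Lemma C_reg_plus k f g : C_reg k f -> C_reg k g -> C_reg k (fun x => f x + g x).
Proof.
  revert f g; induction k as [|k IH]; intros f g Hf Hg.
  - intros x; now apply (continuous_plus (V := R_NormedModule)).
  - destruct Hf as [f' [Df Hf]], Hg as [g' [Dg Hg]].
    exists (fun x => f' x + g' x); split; auto.
    intros x; now apply (is_derive_plus f g).
Qed.

Lemma C_reg_mult k f g : C_reg k f -> C_reg k g -> C_reg k (fun x => f x * g x).
Proof.
  revert f g; induction k as [|k IH]; intros f g Hf Hg.
  - intros x; now apply (continuous_mult (K := R_AbsRing)).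
  - assert (Hf0 := C_reg_pred _ _ Hf); assert (Hg0 := C_reg_pred _ _ Hg).
    destruct Hf as [f' [Df Hf]], Hg as [g' [Dg Hg]].
    exists (fun x => f' x * g x + f x * g' x); split.
    + intros x; apply (is_derive_mult f g); auto; intros; apply Rmult_comm.
    + apply C_reg_plus; auto.
Qed.

Lemma C_reg_const k c : C_reg k (fun _ => c).
Proof.
  revert c; induction k as [|k IH]; intros c.
  - intros x; apply continuous_const.
  - exists (fun _ => 0); split; auto; intros x.
    apply is_derive_constant.
Qed.

Lemma C_reg_scal k c f : C_reg k f -> C_reg k (fun x => c * f x).
Proof. intros Hf; apply C_reg_mult; auto using C_reg_const. Qed.

Lemma C_reg_affine k f a b : C_reg k f -> C_reg k (fun x => f (a * x + b)).
Proof.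
  revert f; induction k as [|k IH]; intros f Hf.
  - intros x; apply (continuous_comp (fun x => a * x + b) f); [|apply Hf].
    apply (ex_derive_continuous (fun x => a * x + b)); auto_derive; auto.
  - destruct Hf as [f' [Df Hf]].
    exists (fun x => a * f' (a * x + b)); split.
    + intros x; apply (is_derive_comp f (fun x => a * x + b)); auto.
      auto_derive; auto; ring.
    + apply C_reg_scal, IH, Hf.
Qed.

Lemma C_reg_inv k g : (forall x, g x <> 0) -> C_reg k g -> C_reg k (fun x => / g x).
Proof.
  intros Hg0; revert g Hg0; induction k as [|k IH]; intros g Hg0 Hg.
  - intros x; apply continuous_Rinv_comp; auto.
  - assert (Hg1 := C_reg_pred _ _ Hg); destruct Hg as [g' [Dg Hg]].
    exists (fun x => (-1) * g' x * (/ g x * / g x)); split.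
    + intros x; replace (-1 * g' x * (/ g x * / g x)) with (- g' x / g x ^ 2)
        by (field; auto).
      apply is_derive_inv; auto.
    + apply C_reg_mult; [now apply C_reg_scal|].
      apply C_reg_mult; auto.
Qed.

Lemma C_reg_id k : C_reg k (fun x => x).
Proof.
  destruct k as [|k].
  - intros x; apply continuous_id.
  - exists (fun _ => 1); split; [|apply C_reg_const].
    intros x; auto_derive; auto.
Qed.

Definition pos_pow (m : nat) (u : R) : R := Rmax 0 u ^ m.

Lemma pos_pow_neg m u : (0 < m)%nat -> u <= 0 -> pos_pow m u = 0.
Proof. intros Hm Hu; unfold pos_pow; rewrite Rmax_left by lra; now apply pow_i. Qed.

Lemma pos_pow_pos m u : 0 <= u -> pos_pow m u = u ^ m.
Proof. intros Hu; unfold pos_pow; now rewrite Rmax_right by lra. Qed.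

Lemma pos_pow_ge0 m u : 0 <= pos_pow m u.
Proof. apply pow_le, Rmax_l. Qed.

Lemma pos_pow_le m u v : u <= v -> pos_pow m u <= pos_pow m v.
Proof.
  intros H; apply pow_incr; split; [apply Rmax_l|].
  apply Rle_max_compat_l, H.
Qed.

(** At the origin the difference quotient is h^(m+1) or 0, and tends to 0. *)
Lemma is_derive_pos_pow m u :
  is_derive (pos_pow (S (S m))) u (INR (S (S m)) * pos_pow (S m) u).
Proof.
  destruct (Rtotal_order u 0) as [Hu|[->|Hu]].
  - rewrite pos_pow_neg by (lra || lia).
    apply (is_derive_ext_loc (fun _ => 0)).
    + exists (mkposreal (- u) ltac:(lra)); intros y Hy.
      rewrite pos_pow_neg; auto; [lia|].
      unfold ball in Hy; simpl in Hy; unfold AbsRing_ball, abs, minus, plus, opp in Hy;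
        simpl in Hy; apply Rabs_def2 in Hy; lra.
    + replace (INR (S (S m)) * 0) with 0 by ring; apply is_derive_constant.
  - rewrite pos_pow_neg by (lra || lia).
    apply is_derive_Reals; intros eps Heps.
    exists (mkposreal (Rmin 1 eps) (Rmin_pos _ _ Rlt_0_1 Heps)); intros h Hh0 Hh.
    simpl in Hh.
    rewrite (pos_pow_neg _ 0) by (lra || lia); rewrite Rplus_0_l, Rmult_0_r, !Rminus_0_r.
    assert (H1 := Rlt_le_trans _ _ _ Hh (Rmin_l _ _)).
    assert (H2 := Rlt_le_trans _ _ _ Hh (Rmin_r _ _)).
    destruct (Rle_or_lt h 0) as [Hn|Hp].
    + rewrite pos_pow_neg by (lra || lia); unfold Rdiv; rewrite Rmult_0_l, Rabs_R0; auto.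
    + rewrite pos_pow_pos by lra.
      replace (h ^ S (S m) / h) with (h * h ^ m) by (simpl; field; lra).
      rewrite Rabs_mult, (Rabs_pos_eq (h ^ m)) by (apply pow_le; lra).
      rewrite Rabs_pos_eq in H1 by lra.
      assert (h ^ m <= 1) by (rewrite <- (pow1 m); apply pow_incr; lra).
      assert (0 <= h ^ m) by (apply pow_le; lra).
      assert (0 <= Rabs h) by apply Rabs_pos; nra.
  - rewrite pos_pow_pos by lra.
    apply (is_derive_ext_loc (fun y => y ^ S (S m))).
    + exists (mkposreal u Hu); intros y Hy.
      rewrite pos_pow_pos; auto.
      unfold ball in Hy; simpl in Hy; unfold AbsRing_ball, abs, minus, plus, opp in Hy;
        simpl in Hy; apply Rabs_def2 in Hy; lra.
    + auto_derive; auto; rewrite Rmult_1_l; reflexivity.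
Qed.

Lemma C_reg_pos_pow k : C_reg k (pos_pow (S k)).
Proof.
  induction k as [|k IH].
  - intros x; unfold pos_pow; apply continuous_ext with (fun u => (0 + u + Rabs (0 - u)) / 2).
    + intros u; unfold Rmax; destruct Rle_dec; rewrite pow_1.
      * rewrite Rabs_left1; lra.
      * rewrite Rabs_pos_eq; lra.
    + apply (continuous_mult (K := R_AbsRing)); [|apply continuous_const].
      apply (continuous_plus (V := R_NormedModule)).
      * apply (continuous_plus (V := R_NormedModule)); [apply continuous_const|apply continuous_id].
      * apply continuous_comp; [|apply continuous_Rabs].
        apply (continuous_minus (V := R_NormedModule)); [apply continuous_const|apply continuous_id].
  - exists (fun u => INR (S (S k)) * pos_pow (S k) u); split.
    + apply is_derive_pos_pow.
    + now apply C_reg_scal.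
Qed.

(** A transition from 0 to 1 on [0, 1].  The quotient form avoids an integral:
    the two truncated powers never vanish together. *)
Definition smooth_step (m : nat) (u : R) : R :=
  pos_pow m u / (pos_pow m u + pos_pow m (1 - u)).

Lemma smooth_step_den m u : (0 < m)%nat -> 0 < pos_pow m u + pos_pow m (1 - u).
Proof.
  intros Hm; destruct (Rle_or_lt u 0) as [H|H].
  - rewrite (pos_pow_neg m u), (pos_pow_pos m (1 - u)) by (lra || lia).
    rewrite Rplus_0_l; apply pow_lt; lra.
  - assert (0 < pos_pow m u) by (rewrite pos_pow_pos by lra; now apply pow_lt).
    generalize (pos_pow_ge0 m (1 - u)); lra.
Qed.

Lemma C_reg_smooth_step k : C_reg k (smooth_step (S k)).
Proof.
  unfold smooth_step, Rdiv; apply C_reg_mult; [apply C_reg_pos_pow|].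
  apply C_reg_inv.
  - intros x; generalize (smooth_step_den (S k) x ltac:(lia)); lra.
  - apply C_reg_plus; [apply C_reg_pos_pow|].
    apply C_reg_ext with (fun u => pos_pow (S k) ((-1) * u + 1)).
    + intros u; f_equal; ring.
    + apply C_reg_affine, C_reg_pos_pow.
Qed.

Lemma smooth_step_0 m u : (0 < m)%nat -> u <= 0 -> smooth_step m u = 0.
Proof. intros; unfold smooth_step; rewrite pos_pow_neg by auto; unfold Rdiv; ring. Qed.

Lemma smooth_step_1 m u : (0 < m)%nat -> 1 <= u -> smooth_step m u = 1.
Proof.
  intros Hm Hu; generalize (smooth_step_den m u Hm); unfold smooth_step.
  rewrite (pos_pow_neg m (1 - u)) by (lra || lia); intros; field; lra.
Qed.

Lemma smooth_step_le m u v : (0 < m)%nat -> u <= v -> smooth_step m u <= smooth_step m v.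
Proof.
  intros Hm Huv; unfold smooth_step.
  assert (H1 := smooth_step_den m u Hm); assert (H2 := smooth_step_den m v Hm).
  assert (H3 := pos_pow_le m u v Huv).
  assert (H4 := pos_pow_le m (1 - v) (1 - u) ltac:(lra)).
  assert (H5 := pos_pow_ge0 m u); assert (H6 := pos_pow_ge0 m (1 - v)).
  apply Rmult_le_reg_r with (pos_pow m u + pos_pow m (1 - u)); auto.
  apply Rmult_le_reg_r with (pos_pow m v + pos_pow m (1 - v)); auto.
  unfold Rdiv.
  replace (pos_pow m u * / (pos_pow m u + pos_pow m (1 - u))
    * (pos_pow m u + pos_pow m (1 - u)) * (pos_pow m v + pos_pow m (1 - v)))
    with (pos_pow m u * (pos_pow m v + pos_pow m (1 - v))) by (field; lra).
  replace (pos_pow m v * / (pos_pow m v + pos_pow m (1 - v))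
    * (pos_pow m u + pos_pow m (1 - u)) * (pos_pow m v + pos_pow m (1 - v)))
    with (pos_pow m v * (pos_pow m u + pos_pow m (1 - u))) by (field; lra).
  nra.
Qed.

Lemma smooth_step_bounds m u : (0 < m)%nat -> 0 <= smooth_step m u <= 1.
Proof.
  intros Hm; split.
  - rewrite <- (smooth_step_0 m (Rmin 0 u) Hm (Rmin_l _ _)).
    apply smooth_step_le; auto using Rmin_r.
  - rewrite <- (smooth_step_1 m (Rmax 1 u) Hm (Rmax_l _ _)).
    apply smooth_step_le; auto using Rmax_r.
Qed.

(** * Derivative bounds at a given scale *)

(** The j-th derivative is at most c / lam^j for j <= k: the size of the
    derivatives of a function that lives at length scale lam.  Carrying the
    scale along avoids Leibniz and Faa di Bruno formulas. *)
Fixpoint deriv_bounds (k : nat) (lam : R) (f : R -> R) (c : R) : Prop :=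
  (forall x, Rabs (f x) <= c) /\
  match k with
  | O => forall x, continuous f x
  | S k => exists f', (forall x, is_derive f x (f' x)) /\ deriv_bounds k lam f' (c / lam)
  end.

Lemma deriv_bounds_abs k lam f c x : deriv_bounds k lam f c -> Rabs (f x) <= c.
Proof. destruct k; simpl; intros [H _]; auto. Qed.

Lemma deriv_bounds_nonneg k lam f c : deriv_bounds k lam f c -> 0 <= c.
Proof.
  intros H; generalize (deriv_bounds_abs k lam f c 0 H), (Rabs_pos (f 0)); lra.
Qed.

Lemma deriv_bounds_le k lam f c c' : 0 < lam -> c <= c' ->
  deriv_bounds k lam f c -> deriv_bounds k lam f c'.
Proof.
  intros Hl; revert f c c'; induction k as [|k IH]; intros f c c' Hc; simpl.
  - intros [H1 H2]; split; auto; intros x; eapply Rle_trans; eauto.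
  - intros [H1 [f' [Hd H2]]]; split; [intros x; eapply Rle_trans; eauto|].
    exists f'; split; auto; apply IH with (c / lam); auto.
    apply Rmult_le_compat_r; auto; left; now apply Rinv_0_lt_compat.
Qed.

Lemma deriv_bounds_pred k lam f c :
  deriv_bounds (S k) lam f c -> deriv_bounds k lam f c.
Proof.
  revert f c; induction k as [|k IH]; intros f c [H1 [f' [Hd H2]]]; split; auto.
  - intros x; apply (ex_derive_continuous f); now exists (f' x).
  - exists f'; auto.
Qed.

Lemma deriv_bounds_ext k lam f g c : (forall x, f x = g x) ->
  deriv_bounds k lam f c -> deriv_bounds k lam g c.
Proof.
  intros He; destruct k as [|k]; simpl.
  - intros [H1 H2]; split; intros x.
    + now rewrite <- He.
    + apply continuous_ext with f; auto.
  - intros [H1 [f' [Hd H2]]]; split; [intros x; now rewrite <- He|].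
    exists f'; split; auto; intros x; apply is_derive_ext with f; auto.
Qed.

Lemma deriv_bounds_plus k lam f c g d :
  deriv_bounds k lam f c -> deriv_bounds k lam g d ->
  deriv_bounds k lam (fun x => f x + g x) (c + d).
Proof.
  revert f c g d; induction k as [|k IH]; intros f c g d [Hf1 Hf2] [Hg1 Hg2]; split.
  1,3: intros x; eapply Rle_trans; [apply Rabs_triang|]; now apply Rplus_le_compat.
  - intros x; now apply (continuous_plus (V := R_NormedModule)).
  - destruct Hf2 as [f' [Df Hf]], Hg2 as [g' [Dg Hg]].
    exists (fun x => f' x + g' x); split.
    + intros x; now apply (is_derive_plus f g).
    + replace ((c + d) / lam) with (c / lam + d / lam) by (unfold Rdiv; ring); auto.
Qed.

(** Each use of the product rule doubles the number of terms. *)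
Lemma deriv_bounds_mult k lam f c g d : 0 < lam ->
  deriv_bounds k lam f c -> deriv_bounds k lam g d ->
  deriv_bounds k lam (fun x => f x * g x) (2 ^ k * (c * d)).
Proof.
  intros Hl; revert f c g d; induction k as [|k IH]; intros f c g d Hf Hg.
  - simpl in *; destruct Hf as [Hf1 Hf2], Hg as [Hg1 Hg2]; split.
    + intros x; rewrite Rabs_mult, Rmult_1_l.
      apply Rmult_le_compat; auto using Rabs_pos.
    + intros x; now apply (continuous_mult (K := R_AbsRing)).
  - assert (Hf0 := deriv_bounds_pred _ _ _ _ Hf).
    assert (Hg0 := deriv_bounds_pred _ _ _ _ Hg).
    assert (c0 := deriv_bounds_nonneg _ _ _ _ Hf).
    assert (d0 := deriv_bounds_nonneg _ _ _ _ Hg).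
    destruct Hf as [Hf1 [f' [Df Hf]]], Hg as [Hg1 [g' [Dg Hg]]].
    split.
    + intros x; rewrite Rabs_mult; apply Rle_trans with (1 * (c * d)).
      * rewrite Rmult_1_l; apply Rmult_le_compat; auto using Rabs_pos.
      * apply Rmult_le_compat_r; [nra|]; apply pow_R1_Rle; lra.
    + exists (fun x => f' x * g x + f x * g' x); split.
      * intros x; apply (is_derive_mult f g); auto; intros; apply Rmult_comm.
      * replace (2 ^ S k * (c * d) / lam)
          with (2 ^ k * (c / lam * d) + 2 ^ k * (c * (d / lam)))
          by (simpl; field; lra).
        apply deriv_bounds_plus; auto.
Qed.

Lemma deriv_bounds_scal k lam a f c : 0 < lam ->
  deriv_bounds k lam f c -> deriv_bounds k lam (fun x => a * f x) (Rabs a * c).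
Proof.
  intros Hl; revert f c; induction k as [|k IH]; intros f c [Hf1 Hf2]; split.
  1,3: intros x; rewrite Rabs_mult; apply Rmult_le_compat_l; auto using Rabs_pos.
  - intros x; apply (continuous_mult (K := R_AbsRing)); auto; apply continuous_const.
  - destruct Hf2 as [f' [Df Hf]]; exists (fun x => a * f' x); split.
    + intros x; now apply is_derive_scal.
    + unfold Rdiv; rewrite Rmult_assoc; apply IH, Hf.
Qed.

Lemma deriv_bounds_rescale k lam f c : 0 < lam <= 1 ->
  deriv_bounds k 1 f c -> deriv_bounds k lam f c.
Proof.
  intros Hl; revert f c; induction k as [|k IH]; intros f c H; [exact H|].
  assert (c0 := deriv_bounds_nonneg _ _ _ _ H).
  destruct H as [H1 [f' [Hd H2]]]; split; auto; exists f'; split; auto.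
  apply IH, deriv_bounds_le with (c / 1); auto; [lra|].
  apply Rmult_le_compat_l; auto; apply Rinv_le_contravar; lra.
Qed.

(** Bernstein's inequality says that a sum of order N lives at scale
    1 / (N+1). *)
Lemma deriv_bounds_half_trig k N f M : half_trig N f -> (forall x, Rabs (f x) <= M) ->
  deriv_bounds k (/ (INR N + 1)) f M.
Proof.
  assert (HN := pos_INR N).
  revert f M; induction k as [|k IH]; intros f M Hf HM; split; auto.
  - intros x; apply (ex_derive_continuous f); exists (Derive f x).
    now apply half_trig_is_derive with N.
  - exists (Derive f); split.
    + intros x; now apply half_trig_is_derive with N.
    + apply IH; [now apply half_trig_Derive|].
      intros x; replace (M / / (INR N + 1)) with ((INR N + 1) * M) by (field; lra).
      now apply bernstein.
Qed.

Lemma deriv_bounds_cos k lam phi : 0 < lam <= 1 ->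
  deriv_bounds k lam (fun x => cos (x / 2 + phi)) 1.
Proof.
  intros Hl; apply deriv_bounds_rescale; auto; clear lam Hl.
  revert phi; induction k as [|k IH]; intros phi; split.
  1,3: intros x; apply Rabs_le, COS_bound.
  - intros x; apply (ex_derive_continuous (fun x => cos (x / 2 + phi))); auto_derive; auto.
  - exists (fun x => / 2 * cos (x / 2 + (phi + PI / 2))); split.
    + intros x; auto_derive; auto; rewrite <- Rplus_assoc, cos_plus, cos_PI2, sin_PI2.
      unfold Rdiv; ring.
    + apply deriv_bounds_le with (Rabs (/ 2) * 1); [lra| |].
      * rewrite Rabs_pos_eq; lra.
      * apply deriv_bounds_scal; auto; lra.
Qed.

(** The map x |-> cos(x/2 + phi) / lam has derivatives of order 1/lam, hence a
    profile at scale 1 is carried to scale lam, with a constant that depends on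
    the number of derivatives only. *)
Lemma deriv_bounds_comp k : exists C, 1 <= C /\ forall psi c lam phi, 0 < lam <= 1 ->
  deriv_bounds k 1 psi c ->
  deriv_bounds k lam (fun x => psi (cos (x / 2 + phi) / lam)) (C * c).
Proof.
  induction k as [|k [C [HC IH]]].
  - exists 1; split; [lra|]; intros psi c lam phi Hl [H1 H2]; split.
    + intros x; rewrite Rmult_1_l; auto.
    + intros x; apply (continuous_comp (fun x => cos (x / 2 + phi) / lam) psi); auto.
      apply (ex_derive_continuous (fun x => cos (x / 2 + phi) / lam)); auto_derive; auto.
  - assert (H2k : 1 <= 2 ^ k) by (apply pow_R1_Rle; lra).
    exists (2 ^ k * C); split; [nra|].
    intros psi c lam phi Hl H.
    assert (c0 := deriv_bounds_nonneg _ _ _ _ H).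
    destruct H as [H1 [psi' [Hd H2]]]; split.
    + intros x; apply Rle_trans with (1 * c); [rewrite Rmult_1_l; auto|].
      apply Rmult_le_compat_r; auto; nra.
    + exists (fun x => / (2 * lam) *
        (psi' (cos (x / 2 + phi) / lam) * cos (x / 2 + (phi + PI / 2)))); split.
      * intros x.
        replace (/ (2 * lam) *
           (psi' (cos (x / 2 + phi) / lam) * cos (x / 2 + (phi + PI / 2))))
          with (scal (/ (2 * lam) * cos (x / 2 + (phi + PI / 2)))
                 (psi' (cos (x / 2 + phi) / lam)))
          by (unfold scal; simpl; unfold mult; simpl; ring).
        apply (is_derive_comp psi (fun x => cos (x / 2 + phi) / lam)); auto.
        auto_derive; auto; rewrite <- Rplus_assoc, (cos_plus _ (PI / 2)), cos_PI2, sin_PI2.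
        unfold Rdiv; field; lra.
      * replace (2 ^ k * C * c / lam) with (2 * (/ (2 * lam) * (2 ^ k * (C * c * 1))))
          by (field; lra).
        apply deriv_bounds_le with (Rabs (/ (2 * lam)) * (2 ^ k * (C * c * 1))); [lra| |].
        -- assert (0 < / (2 * lam)) by (apply Rinv_0_lt_compat; lra).
           rewrite Rabs_pos_eq by lra.
           assert (0 <= C * c) by nra.
           assert (0 <= / (2 * lam) * (2 ^ k * (C * c * 1))) by (repeat apply Rmult_le_pos; lra).
           lra.
        -- apply deriv_bounds_scal, deriv_bounds_mult; try lra.
           ++ apply IH; auto; now replace c with (c / 1) by field.
           ++ now apply deriv_bounds_cos.
Qed.

Lemma deriv_bounds_compact k f a b : a <= b -> C_reg k f ->
  (forall x, x < a \/ b < x -> f x = 0) -> exists c, deriv_bounds k 1 f c.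
Proof.
  intros Hab; revert f; induction k as [|k IH]; intros f Hf H0.
  all: assert (Hc : exists c, forall x, Rabs (f x) <= c).
  1,3: destruct (continuity_ab_maj (fun x => Rabs (f x)) a b Hab) as [z [Hz _]];
    [ intros c _; apply continuity_pt_filterlim;
      apply (continuous_comp f Rabs); [eapply C_reg_continuous; eauto|apply continuous_Rabs]
    | exists (Rabs (f z)); intros x;
      destruct (Rlt_or_le x a); [rewrite H0, Rabs_R0 by lra; apply Rabs_pos|];
      destruct (Rlt_or_le b x); [rewrite H0, Rabs_R0 by lra; apply Rabs_pos|]; auto ].
  - destruct Hc as [c Hc]; exists c; split; auto.
  - destruct Hc as [c Hc], Hf as [f' [Df Hf']].
    destruct (IH f' Hf') as [c' Hc'].
    { intros x Hx; rewrite <- (is_derive_unique _ _ _ (Df x)).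
      apply is_derive_unique; apply (is_derive_ext_loc (fun _ => 0)).
      - set (d := Rmax (a - x) (x - b)).
        assert (Hd : 0 < d) by (unfold d, Rmax; destruct Rle_dec; lra).
        exists (mkposreal d Hd); intros y Hy; rewrite H0; auto.
        unfold ball in Hy; simpl in Hy; unfold AbsRing_ball, abs, minus, plus, opp in Hy;
          simpl in Hy; apply Rabs_def2 in Hy.
        unfold d, Rmax in Hy; destruct Rle_dec; lra.
      - apply is_derive_constant. }
    exists (Rmax c c'); split.
    + intros x; eapply Rle_trans; [apply Hc|apply Rmax_l].
    + exists f'; split; auto; apply deriv_bounds_le with c'; auto; [lra|].
      replace (Rmax c c' / 1) with (Rmax c c') by field; apply Rmax_r.
Qed.

Lemma deriv_bounds_Derive_n k lam f c : 0 < lam -> deriv_bounds k lam f c ->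
  forall j, (j <= k)%nat -> forall x,
    ex_derive_n f j x /\ Rabs (Derive_n f j x) <= c / lam ^ j /\ continuous (Derive_n f j) x.
Proof.
  intros Hl; revert f c; induction k as [|k IH]; intros f c H j Hj x.
  - replace j with 0%nat by lia; simpl; destruct H as [H1 H2]; repeat split; auto.
    unfold Rdiv; rewrite Rinv_1, Rmult_1_r; auto.
  - destruct H as [H1 [f' [Df H2]]]; destruct j as [|j].
    + simpl; repeat split; auto.
      * unfold Rdiv; rewrite Rinv_1, Rmult_1_r; auto.
      * apply (ex_derive_continuous f); now exists (f' x).
    + assert (E : forall j y, Derive_n f (S j) y = Derive_n f' j y).
      { intros i y; rewrite Derive_n_S_inner; apply Derive_n_ext.
        intros t; now apply is_derive_unique. }
      destruct (IH _ _ H2 j ltac:(lia) x) as [_ [B K]].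
      split; [|split].
      * destruct j as [|j].
        { exists (f' x); apply Df. }
        simpl; apply (ex_derive_ext (Derive_n f' j)); [intros t; symmetry; apply E|].
        apply (IH _ _ H2 (S j) ltac:(lia) x).
      * rewrite E; replace (c / lam ^ S j) with (c / lam / lam ^ j); auto.
        simpl; field; split; auto using pow_nonzero with real; lra.
      * apply continuous_ext with (Derive_n f' j); auto; intros t; now rewrite E.
Qed.

(** * The extremal function *)

Definition cutoff (m : nat) (u : R) : R := smooth_step m (2 - u).

Lemma cutoff_1 m u : (0 < m)%nat -> u <= 1 -> cutoff m u = 1.
Proof. intros; apply smooth_step_1; auto; lra. Qed.

Lemma cutoff_0 m u : (0 < m)%nat -> 2 <= u -> cutoff m u = 0.
Proof. intros; apply smooth_step_0; auto; lra. Qed.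

Lemma C_reg_cutoff k : C_reg k (cutoff (S k)).
Proof.
  apply C_reg_ext with (fun u => smooth_step (S k) ((-1) * u + 2)).
  - intros u; unfold cutoff; f_equal; ring.
  - apply C_reg_affine, C_reg_smooth_step.
Qed.

(** Evaluated at cos(x/2), this selects the arc of the circle around 0 and
    discards the arc around 2 pi, where sin(x/2) is small as well.  The second
    factor equals 1 for all values of the cosine; it only gives the function a
    compact support, from which bounds for its derivatives follow. *)
Definition side (m : nat) (w : R) : R := smooth_step m (2 * w) * cutoff m w.

Lemma side_0 m w : (0 < m)%nat -> w <= 0 -> side m w = 0.
Proof. intros; unfold side; rewrite smooth_step_0 by (lra || lia); ring. Qed.

Lemma side_1 m w : (0 < m)%nat -> / 2 <= w <= 1 -> side m w = 1.
Proof.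
  intros; unfold side; rewrite smooth_step_1, cutoff_1 by (lra || lia); ring.
Qed.

Definition power_bump (m : nat) (u : R) : R := pos_pow m u * cutoff m u.

(** Near 0 this is, with v = x/2, v^(2s+2) - b v^(2s+1): it has a dip of depth of
    order b^(2s+2) just to the right of 0.  The cube of the cosine places the
    maximum exactly at pi. *)
Definition profile (s : nat) (b x : R) : R :=
  sin (x / 2) ^ (2 * s + 1) * (sin (x / 2) - b * cos (x / 2) ^ 3).

(** Minus the profile times the cutoff of sin(x/2)/b, restricted to the side of
    0 where sin(x/2) and cos(x/2) are positive (phi = 0) or both negative
    (phi = pi).  In the rescaled variable u = sin(x/2)/b the power of b comes out
    as a factor, and what remains are fixed functions of u. *)
Definition patch (s : nat) (b phi x : R) : R :=
  let u := cos (x / 2 + (phi - PI / 2)) / b in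
  let w := cos (x / 2 + phi) in
  - b ^ (2 * s + 2) *
    ((u * power_bump (2 * s + 1) u - power_bump (2 * s + 1) u * w ^ 3)
     * side (2 * s + 1) w).

(** The two patches together are 2 pi-periodic.  They erase the dip: the result
    vanishes on a short interval to the right of 0. *)
Definition flattened (s : nat) (b x : R) : R :=
  profile s b x + (patch s b 0 x + patch s b PI x).

Lemma half_trig_profile_factor b :
  half_trig 3 (fun x => sin (x / 2) - b * cos (x / 2) ^ 3).
Proof.
  apply half_trig_minus.
  - apply half_trig_le with 1%nat; [lia|].
    apply half_trig_ext with (fun x => 1 * sin (x / 2)); [|intros; ring].
    apply half_trig_mul_sin, half_trig_const.
  - apply half_trig_scal.
    apply half_trig_ext with
      (fun x => 1 * cos (x / 2 + 0) * cos (x / 2 + 0) * cos (x / 2 + 0)).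
    + do 3 apply half_trig_mul_cos; apply half_trig_const.
    + intros x; rewrite Rplus_0_r; ring.
Qed.

Lemma half_trig_profile s b : half_trig (2 * s + 4) (profile s b).
Proof.
  replace (2 * s + 4)%nat with (2 * s + 1 + 3)%nat by lia.
  apply half_trig_sin_pow, half_trig_profile_factor.
Qed.

Lemma profile_bound s b x : 0 <= b <= 1 -> Rabs (profile s b x) <= 2.
Proof.
  intros Hb; unfold profile; rewrite Rabs_mult, <- RPow_abs.
  assert (Hs : Rabs (sin (x / 2)) <= 1) by apply Rabs_le, SIN_bound.
  assert (Hc : Rabs (cos (x / 2)) <= 1) by apply Rabs_le, COS_bound.
  apply Rle_trans with (1 * 2); [|lra].
  apply Rmult_le_compat; try apply Rabs_pos.
  - apply pow_le, Rabs_pos.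
  - rewrite <- (pow1 (2 * s + 1)); apply pow_incr; split; auto; apply Rabs_pos.
  - eapply Rle_trans; [apply Rabs_triang|].
    rewrite Rabs_Ropp, Rabs_mult, (Rabs_pos_eq b), <- RPow_abs by lra.
    assert (Rabs (cos (x / 2)) ^ 3 <= 1).
    { rewrite <- (pow1 3); apply pow_incr; split; auto; apply Rabs_pos. }
    assert (0 <= Rabs (cos (x / 2)) ^ 3) by apply pow_le, Rabs_pos.
    nra.
Qed.

Lemma deriv_bounds_power_bump m i : exists c,
  deriv_bounds m 1 (fun u => u ^ i * power_bump (S m) u) c.
Proof.
  apply deriv_bounds_compact with 0 2; [lra| |].
  - apply C_reg_mult.
    + induction i as [|i IH]; [exact (C_reg_const m 1)|].
      exact (C_reg_mult m _ _ (C_reg_id m) IH).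
    + apply C_reg_mult; [apply C_reg_pos_pow|apply C_reg_cutoff].
  - intros x Hx; unfold power_bump.
    destruct Hx; [rewrite pos_pow_neg|rewrite cutoff_0]; try lia; try lra; ring.
Qed.

Lemma deriv_bounds_side m : exists c, deriv_bounds m 1 (side (S m)) c.
Proof.
  apply deriv_bounds_compact with 0 2; [lra| |].
  - apply C_reg_mult; [|apply C_reg_cutoff].
    apply C_reg_ext with (fun u => smooth_step (S m) (2 * u + 0)).
    + intros u; f_equal; ring.
    + apply C_reg_affine, C_reg_smooth_step.
  - intros x Hx; destruct Hx; [apply side_0; lra || lia|].
    unfold side; rewrite cutoff_0 by (lra || lia); ring.
Qed.

(** In particular the derivative of order 2s-1 of a patch is O(b^3), whatever s
    is. *)
Lemma deriv_bounds_patch s : exists C, 1 <= C /\ forall b phi, 0 < b <= 1 ->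
  deriv_bounds (2 * s) b (patch s b phi) (C * b ^ (2 * s + 2)).
Proof.
  destruct (deriv_bounds_power_bump (2 * s) 1) as [c1 H1].
  destruct (deriv_bounds_power_bump (2 * s) 0) as [c0 H0].
  destruct (deriv_bounds_side (2 * s)) as [c2 H2].
  destruct (deriv_bounds_comp (2 * s)) as [C [HC Hcomp]].
  set (t := 2 ^ (2 * s)).
  set (A := t * ((C * c1 + Rabs (-1) * (t * (C * c0 * (t * (1 * (t * (1 * 1))))))) * (C * c2))).
  exists (Rabs A + 1); split; [generalize (Rabs_pos A); lra|].
  intros b phi Hb.
  assert (Hbp : 0 < b ^ (2 * s + 2)) by (apply pow_lt; lra).
  apply deriv_bounds_le with (Rabs (- b ^ (2 * s + 2)) * A); [lra| |].
  { rewrite Rabs_Ropp, Rabs_pos_eq by lra; generalize (Rle_abs A); nra. }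
  unfold patch; cbv zeta; apply deriv_bounds_scal; [lra|].
  apply deriv_bounds_mult; [lra| |].
  - apply deriv_bounds_ext with (fun x =>
      (fun u => u ^ 1 * power_bump (S (2 * s)) u) (cos (x / 2 + (phi - PI / 2)) / b)
      + (-1) * ((fun u => u ^ 0 * power_bump (S (2 * s)) u) (cos (x / 2 + (phi - PI / 2)) / b)
         * (cos (x / 2 + phi) * (cos (x / 2 + phi) * cos (x / 2 + phi))))).
    { intros x; replace (2 * s + 1)%nat with (S (2 * s)) by lia; ring. }
    apply deriv_bounds_plus.
    + exact (Hcomp _ c1 b _ Hb H1).
    + apply deriv_bounds_scal; [lra|].
      apply deriv_bounds_mult; [lra|exact (Hcomp _ c0 b _ Hb H0)|].
      apply deriv_bounds_mult; [lra|now apply deriv_bounds_cos|].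
      apply deriv_bounds_mult; [lra| |]; now apply deriv_bounds_cos.
  - apply deriv_bounds_ext with (fun x => side (S (2 * s)) (cos (x / 2 + phi) / 1)).
    { intros x; replace (2 * s + 1)%nat with (S (2 * s)) by lia; f_equal; field. }
    apply deriv_bounds_rescale; auto; apply Hcomp; auto; lra.
Qed.

Lemma cos_minus_PI2 y : cos (y - PI / 2) = sin y.
Proof. rewrite cos_minus, cos_PI2, sin_PI2; ring. Qed.

Lemma half_angle_0_PI x : 0 <= x <= PI -> 0 <= sin (x / 2) <= 1 /\ 0 <= cos (x / 2) <= 1.
Proof.
  intros Hx; assert (HP := PI_RGT_0).
  destruct (SIN_bound (x / 2)), (COS_bound (x / 2)); repeat split; auto.
  - apply sin_ge_0; lra.
  - apply cos_ge_0; lra.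
Qed.

Lemma half_angle_PI_2PI x : PI <= x <= 2 * PI ->
  0 <= sin (x / 2) <= 1 /\ -1 <= cos (x / 2) <= 0.
Proof.
  intros Hx; assert (HP := PI_RGT_0).
  destruct (SIN_bound (x / 2)), (COS_bound (x / 2)); repeat split; auto.
  - apply sin_ge_0; lra.
  - apply cos_le_0; lra.
Qed.

Lemma patch_PI_0 s b x : 0 < b -> 0 <= sin (x / 2) -> patch s b PI x = 0.
Proof.
  intros Hb Hs; unfold patch; cbv zeta.
  replace (x / 2 + (PI - PI / 2)) with (x / 2 + PI - PI / 2) by ring.
  rewrite cos_minus_PI2, neg_sin; unfold power_bump; rewrite pos_pow_neg; [ring|lia|].
  apply (Rmult_le_reg_r b); auto; unfold Rdiv; rewrite Rmult_assoc, Rinv_l; lra.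
Qed.

(** Where the cutoff is nonzero, sin(x/2) < 2b <= 1/2 and the cosine exceeds 1/2,
    so that the side factor is 1. *)
Lemma flattened_0_PI s b x : 0 < b <= 1 / 4 -> 0 <= x <= PI ->
  flattened s b x = profile s b x * (1 - cutoff (2 * s + 1) (sin (x / 2) / b)).
Proof.
  intros Hb Hx; destruct (half_angle_0_PI x Hx) as [Hs Hc].
  unfold flattened; rewrite patch_PI_0 by lra.
  enough (patch s b 0 x = - profile s b x * cutoff (2 * s + 1) (sin (x / 2) / b)) as -> by ring.
  unfold patch; cbv zeta; rewrite Rplus_0_r.
  replace (x / 2 + (0 - PI / 2)) with (x / 2 - PI / 2) by ring; rewrite cos_minus_PI2.
  set (v := sin (x / 2)) in *; set (w := cos (x / 2)) in *.
  unfold power_bump.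
  destruct (Rle_or_lt (2 * b) v) as [Hv|Hv].
  { assert (2 <= v / b).
    { apply (Rmult_le_reg_r b); [lra|]; unfold Rdiv; rewrite Rmult_assoc, Rinv_l; lra. }
    rewrite cutoff_0 by (lra || lia); ring. }
  rewrite side_1, pos_pow_pos; try lia.
  - unfold profile; fold v w.
    replace (2 * s + 2)%nat with (S (2 * s + 1)) by lia.
    unfold Rdiv; rewrite Rpow_mult_distr, pow_inv; simpl; field.
    repeat split; try apply pow_nonzero; lra.
  - apply Rmult_le_pos; [lra|]; left; apply Rinv_0_lt_compat; lra.
  - assert (E : v * v + w * w = 1).
    { generalize (sin2_cos2 (x / 2)); unfold Rsqr; fold v w; auto. }
    split; [nra|lra].
Qed.

Lemma flattened_PI_2PI s b x : 0 < b -> PI <= x <= 2 * PI ->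
  flattened s b x = profile s b x.
Proof.
  intros Hb Hx; destruct (half_angle_PI_2PI x Hx) as [Hs Hc].
  unfold flattened; rewrite patch_PI_0 by lra.
  unfold patch; cbv zeta; rewrite Rplus_0_r, side_0 by (lia || (rewrite ?Rplus_0_r; lra)).
  ring.
Qed.

Lemma flattened_flat s b x : 0 < b <= 1 / 4 -> 0 <= x <= PI -> sin (x / 2) <= b ->
  flattened s b x = 0.
Proof.
  intros Hb Hx Hs; rewrite flattened_0_PI, cutoff_1; auto; [ring|lia|].
  apply (Rmult_le_reg_r b); [lra|]; unfold Rdiv; rewrite Rmult_assoc, Rinv_l; lra.
Qed.

Lemma profile_periodic s b x : profile s b (x + 2 * PI) = profile s b x.
Proof.
  unfold profile; replace ((x + 2 * PI) / 2) with (x / 2 + PI) by field.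
  rewrite neg_sin, neg_cos.
  rewrite !pow_add, !pow_mult; replace ((- sin (x / 2)) ^ 2) with (sin (x / 2) ^ 2) by ring.
  ring.
Qed.

Lemma cos_add_2PI y : cos (y + 2 * PI) = cos y.
Proof. rewrite cos_plus, cos_2PI, sin_2PI; ring. Qed.

Lemma flattened_periodic s b x : flattened s b (x + 2 * PI) = flattened s b x.
Proof.
  unfold flattened; rewrite profile_periodic; f_equal; rewrite Rplus_comm; f_equal;
    unfold patch; cbv zeta.
  - replace ((x + 2 * PI) / 2 + (PI - PI / 2))
      with ((x / 2 + (0 - PI / 2)) + 2 * PI) by field.
    replace ((x + 2 * PI) / 2 + PI) with ((x / 2 + 0) + 2 * PI) by field.
    now rewrite !cos_add_2PI.
  - replace ((x + 2 * PI) / 2 + (0 - PI / 2)) with (x / 2 + (PI - PI / 2)) by field.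
    now replace ((x + 2 * PI) / 2 + 0) with (x / 2 + PI) by field.
Qed.

Lemma profile_le s v1 v2 w1 w2 b : 0 <= v1 <= v2 ->
  0 <= v1 - b * w1 ^ 3 <= v2 - b * w2 ^ 3 ->
  v1 ^ (2 * s + 1) * (v1 - b * w1 ^ 3) <= v2 ^ (2 * s + 1) * (v2 - b * w2 ^ 3).
Proof.
  intros Hv Hf; apply Rmult_le_compat; try lra.
  - apply pow_le; lra.
  - apply pow_incr; lra.
Qed.

Lemma flattened_increasing s b x y : 0 < b <= 1 / 4 -> 0 <= x -> x <= y -> y <= PI ->
  flattened s b x <= flattened s b y.
Proof.
  intros Hb Hx Hxy Hy.
  destruct (half_angle_0_PI x ltac:(lra)) as [Hsx Hcx].
  destruct (half_angle_0_PI y ltac:(lra)) as [Hsy Hcy].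
  assert (Hs : sin (x / 2) <= sin (y / 2)) by (apply sin_incr_1; lra).
  assert (Hc : cos (y / 2) <= cos (x / 2)) by (apply cos_decr_1; lra).
  assert (Hc3y : 0 <= cos (y / 2) ^ 3 <= 1).
  { split; [apply pow_le; lra|]; rewrite <- (pow1 3); apply pow_incr; lra. }
  assert (Hc3 : 0 <= cos (y / 2) ^ 3 <= cos (x / 2) ^ 3).
  { split; [lra|]; apply pow_incr; lra. }
  assert (Hc3x : cos (x / 2) ^ 3 <= 1) by (rewrite <- (pow1 3); apply pow_incr; lra).
  assert (Hm : (0 < 2 * s + 1)%nat) by lia.
  rewrite (flattened_0_PI s b y) by lra.
  assert (B := smooth_step_bounds (2 * s + 1) (2 - sin (y / 2) / b) Hm).
  fold (cutoff (2 * s + 1) (sin (y / 2) / b)) in B.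
  destruct (Rle_or_lt (sin (x / 2)) b) as [Hbx|Hbx].
  - rewrite flattened_flat by lra.
    destruct (Rle_or_lt (sin (y / 2)) b) as [Hby|Hby].
    + rewrite cutoff_1; [lra|auto|].
      apply (Rmult_le_reg_r b); [lra|]; unfold Rdiv; rewrite Rmult_assoc, Rinv_l; lra.
    + apply Rmult_le_pos; [|lra]; apply Rmult_le_pos; [apply pow_le; lra|nra].
  - rewrite flattened_0_PI by lra.
    assert (B' := smooth_step_bounds (2 * s + 1) (2 - sin (x / 2) / b) Hm).
    fold (cutoff (2 * s + 1) (sin (x / 2) / b)) in B'.
    apply Rmult_le_compat; try lra.
    + apply Rmult_le_pos; [apply pow_le; lra|nra].
    + apply profile_le; [lra|nra].
    + enough (cutoff (2 * s + 1) (sin (y / 2) / b) <= cutoff (2 * s + 1) (sin (x / 2) / b)) by lra.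
      apply smooth_step_le; auto.
      enough (sin (x / 2) / b <= sin (y / 2) / b) by lra.
      apply Rmult_le_compat_r; [left; apply Rinv_0_lt_compat|]; lra.
Qed.

(** On this quarter of the unit circle
    w2^3 - w1^3 <= 2 (w1^2 - w2^2) = 2 (v2^2 - v1^2) <= 4 (v2 - v1), which is why
    b <= 1/4 suffices. *)
Lemma cube_diff_le v1 v2 w1 w2 b : 0 < b <= 1 / 4 ->
  0 <= v1 <= v2 -> v2 <= 1 -> -1 <= w1 <= w2 -> w2 <= 0 ->
  v1 * v1 + w1 * w1 = 1 -> v2 * v2 + w2 * w2 = 1 ->
  v1 - b * w1 ^ 3 <= v2 - b * w2 ^ 3.
Proof.
  intros Hb Hv Hv2 Hw Hw2 E1 E2.
  assert (H1 : (w2 - w1) * (- w1 - w2) = (v2 - v1) * (v1 + v2)) by nra.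
  assert (H2 : (w2 - w1) * (- w1 - w2) <= 2 * (v2 - v1)) by nra.
  assert (H3 : w1 * w1 + w1 * w2 + w2 * w2 <= 2 * (- w1 - w2)) by nra.
  assert (H4 : (w2 - w1) * (w1 * w1 + w1 * w2 + w2 * w2)
             <= (w2 - w1) * (2 * (- w1 - w2))) by (apply Rmult_le_compat_l; lra).
  assert (H5 : w2 ^ 3 - w1 ^ 3 = (w2 - w1) * (w1 * w1 + w1 * w2 + w2 * w2)) by ring.
  nra.
Qed.

Lemma flattened_decreasing s b x y : 0 < b <= 1 / 4 -> PI <= x -> x <= y -> y <= 2 * PI ->
  flattened s b y <= flattened s b x.
Proof.
  intros Hb Hx Hxy Hy; assert (HP := PI_RGT_0).
  rewrite !flattened_PI_2PI by lra.
  destruct (half_angle_PI_2PI x ltac:(lra)) as [Hsx Hcx].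
  destruct (half_angle_PI_2PI y ltac:(lra)) as [Hsy Hcy].
  assert (Hs : sin (y / 2) <= sin (x / 2)) by (apply sin_decr_1; lra).
  assert (Hc : cos (y / 2) <= cos (x / 2)) by (apply cos_decr_1; lra).
  assert (E1 := sin2_cos2 (x / 2)); assert (E2 := sin2_cos2 (y / 2)); unfold Rsqr in *.
  apply profile_le; [lra|]; split.
  - enough (cos (y / 2) ^ 3 <= 0) by nra.
    replace (cos (y / 2) ^ 3) with (- (- cos (y / 2)) ^ 3) by ring.
    generalize (pow_le (- cos (y / 2)) 3); lra.
  - apply cube_diff_le; lra.
Qed.

Lemma periodic_Z (f : R -> R) (q : Z) x : (forall x, f (x + 2 * PI) = f x) ->
  f (x + 2 * PI * IZR q) = f x.
Proof.
  intros Hf; revert x; pattern q; apply Z.peano_ind; clear q.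
  - intros x; f_equal; ring.
  - intros q IH x; rewrite succ_IZR, <- (IH x), <- (Hf (x + 2 * PI * IZR q)); f_equal; ring.
  - intros q IH x; rewrite <- (IH x), <- (Hf (x + 2 * PI * IZR (Z.pred q))); f_equal.
    replace q with (Z.succ (Z.pred q)) at 2 by lia; rewrite succ_IZR; ring.
Qed.

(** * The points of change of monotonicity *)

(** In each period there is one point at pi and 2s-1 points inside (0, d), at
    multiples of d/(2s).  The period is taken from pi on, so that the index 0 of
    a block is the point pi; thus the sign (-1)^(i-1) on the interval before the
    i-th point depends on the position m of the point in its block only. *)
Definition cluster_point (s : nat) (d : R) (m : Z) : R :=
  if Z.eq_dec m 0 then 0 else PI + d * (IZR m / IZR (2 * Z.of_nat s)).

Definition cluster (s : nat) (d : R) (i : Z) : R :=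
  PI + 2 * PI * IZR ((i - 1) / (2 * Z.of_nat s))
  + cluster_point s d ((i - 1) mod (2 * Z.of_nat s)).

Lemma cluster_eq s d q m : (1 <= s)%nat -> (0 <= m < 2 * Z.of_nat s)%Z ->
  cluster s d (1 + (2 * Z.of_nat s * q + m)) = PI + 2 * PI * IZR q + cluster_point s d m.
Proof.
  intros Hs Hm; unfold cluster.
  replace (1 + (2 * Z.of_nat s * q + m) - 1)%Z with (2 * Z.of_nat s * q + m)%Z by ring.
  rewrite <- (Z.div_unique _ (2 * Z.of_nat s) q m) by (lia || ring).
  rewrite <- (Z.mod_unique _ (2 * Z.of_nat s) q m) by (lia || ring); easy.
Qed.

Lemma cluster_index s i : (1 <= s)%nat -> exists q m, (0 <= m < 2 * Z.of_nat s)%Z /\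
  i = (1 + (2 * Z.of_nat s * q + m))%Z.
Proof.
  intros Hs; exists ((i - 1) / (2 * Z.of_nat s))%Z, ((i - 1) mod (2 * Z.of_nat s))%Z; split.
  - apply Z.mod_pos_bound; lia.
  - rewrite <- Z.div_mod; lia.
Qed.

Lemma cluster_ratio s m : (1 <= s)%nat -> (0 <= m < 2 * Z.of_nat s)%Z ->
  0 <= IZR m / IZR (2 * Z.of_nat s) < 1.
Proof.
  intros Hs Hm; assert (0 < IZR (2 * Z.of_nat s)) by (apply IZR_lt; lia).
  assert (0 <= IZR m) by (apply IZR_le; lia).
  assert (IZR m < IZR (2 * Z.of_nat s)) by (apply IZR_lt; lia).
  split; [apply Rmult_le_pos; auto; left; now apply Rinv_0_lt_compat|].
  apply (Rmult_lt_reg_r (IZR (2 * Z.of_nat s))); auto.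
  unfold Rdiv; rewrite Rmult_assoc, Rinv_l; lra.
Qed.

Lemma collection_cluster s d : (1 <= s)%nat -> 0 < d < PI -> collection s (cluster s d).
Proof.
  intros Hs Hd; assert (Hp : 0 < IZR (2 * Z.of_nat s)) by (apply IZR_lt; lia).
  split; intros i; destruct (cluster_index s i Hs) as [q [m [Hm ->]]].
  - rewrite cluster_eq by auto.
    destruct (Z.eq_dec (m + 1) (2 * Z.of_nat s)) as [Hm1|Hm1].
    + replace (1 + (2 * Z.of_nat s * q + m) + 1)%Z
        with (1 + (2 * Z.of_nat s * (q + 1) + 0))%Z by lia.
      rewrite cluster_eq, plus_IZR by lia; unfold cluster_point.
      destruct (Z.eq_dec 0 0) as [_|]; [|easy].
      destruct Z.eq_dec; [lra|].
      generalize (cluster_ratio s m Hs Hm); nra.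
    + replace (1 + (2 * Z.of_nat s * q + m) + 1)%Z
        with (1 + (2 * Z.of_nat s * q + (m + 1)))%Z by lia.
      rewrite cluster_eq by lia; unfold cluster_point.
      destruct (Z.eq_dec (m + 1) 0) as [|_]; [lia|].
      destruct Z.eq_dec.
      * generalize (cluster_ratio s (m + 1) Hs ltac:(lia)); nra.
      * enough (IZR m / IZR (2 * Z.of_nat s) < IZR (m + 1) / IZR (2 * Z.of_nat s)) by nra.
        apply Rmult_lt_compat_r; [now apply Rinv_0_lt_compat|apply IZR_lt; lia].
  - replace (1 + (2 * Z.of_nat s * q + m) + 2 * Z.of_nat s)%Z
      with (1 + (2 * Z.of_nat s * (q + 1) + m))%Z by lia.
    rewrite !cluster_eq, plus_IZR by auto; ring.
Qed.

Lemma powerRZ_neg1_even k : powerRZ (-1) (2 * k) = 1.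
Proof.
  replace (2 * k)%Z with (k + k)%Z by lia.
  rewrite powerRZ_add, <- powerRZ_mult by lra.
  replace (-1 * -1) with 1 by ring; apply powerRZ_R1.
Qed.

Lemma powerRZ_neg1_odd k : powerRZ (-1) (2 * k + 1) = -1.
Proof. rewrite powerRZ_add, powerRZ_neg1_even, powerRZ_1 by lra; ring. Qed.

(** Between points of the cluster the function vanishes, and the two long
    intervals are, up to such a flat piece, the halves of the period. *)
Lemma Delta1_cluster s d f : (1 <= s)%nat -> 0 < d < PI -> Cper f ->
  (forall x y, 0 <= x -> x <= y -> y <= PI -> f x <= f y) ->
  (forall x y, PI <= x -> x <= y -> y <= 2 * PI -> f y <= f x) ->
  (forall x, 0 <= x <= d -> f x = 0) ->
  Delta1 (cluster s d) f.
Proof.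
  intros Hs Hd [Hc Hper] Hinc Hdec Hflat; split; [now split|].
  assert (Hp : 0 < IZR (2 * Z.of_nat s)) by (apply IZR_lt; lia).
  intros i x y; destruct (cluster_index s i Hs) as [q [m [Hm ->]]].
  rewrite cluster_eq by auto.
  replace (1 + (2 * Z.of_nat s * q + m) - 1)%Z with (2 * Z.of_nat s * q + m)%Z by lia.
  assert (Hr : forall k, (0 <= k < 2 * Z.of_nat s)%Z ->
    0 <= d * (IZR k / IZR (2 * Z.of_nat s)) <= d).
  { intros k Hk; generalize (cluster_ratio s k Hs Hk); nra. }
  destruct (Z.eq_dec m 0) as [->|Hm0].
  - replace (2 * Z.of_nat s * q + 0)%Z
      with (1 + (2 * Z.of_nat s * (q - 1) + (2 * Z.of_nat s - 1)))%Z at 1 by lia.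
    rewrite cluster_eq, minus_IZR by lia; unfold cluster_point.
    destruct (Z.eq_dec 0 0) as [_|]; [|easy].
    destruct Z.eq_dec; [lia|].
    replace (2 * Z.of_nat s * q + 0)%Z with (2 * (Z.of_nat s * q))%Z by lia.
    rewrite powerRZ_neg1_even; intros H1 H2 H3.
    generalize (Hr (2 * Z.of_nat s - 1)%Z ltac:(lia)); intros H4.
    rewrite <- (periodic_Z f (- q) x Hper), <- (periodic_Z f (- q) y Hper), opp_IZR.
    enough (f (x + 2 * PI * - IZR q) <= f (y + 2 * PI * - IZR q)) by lra.
    apply Hinc; lra.
  - replace (2 * Z.of_nat s * q + m)%Z
      with (1 + (2 * Z.of_nat s * q + (m - 1)))%Z at 1 by lia.
    rewrite cluster_eq by lia; unfold cluster_point.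
    destruct (Z.eq_dec m 0) as [|_]; [easy|].
    destruct Z.eq_dec as [Hm1|Hm1].
    + replace m with 1%Z by lia.
      replace (2 * Z.of_nat s * q + 1)%Z with (2 * (Z.of_nat s * q) + 1)%Z by lia.
      rewrite powerRZ_neg1_odd; intros H1 H2 H3.
      generalize (Hr 1%Z ltac:(lia)); intros H4.
      rewrite <- (periodic_Z f (- q) x Hper), <- (periodic_Z f (- q) y Hper), opp_IZR.
      enough (f (y + 2 * PI * - IZR q) <= f (x + 2 * PI * - IZR q)) by lra.
      assert (Hx0 : PI <= x + 2 * PI * - IZR q) by lra.
      assert (Hy0 : y + 2 * PI * - IZR q <= 2 * PI + d) by lra.
      assert (Hxy : x + 2 * PI * - IZR q <= y + 2 * PI * - IZR q) by lra.
      revert Hx0 Hy0 Hxy; generalize (x + 2 * PI * - IZR q), (y + 2 * PI * - IZR q).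
      clear - Hdec Hflat Hper Hd; intros x y Hx Hy Hxy.
      (* beyond 2 PI the function is flat, so points there may be moved back to 2 PI *)
      assert (Hz : forall z, 2 * PI <= z <= 2 * PI + d -> f z = f (2 * PI)).
      { intros z Hz; replace z with (z - 2 * PI + 2 * PI) by ring.
        replace (2 * PI) with (0 + 2 * PI) at 3 by ring.
        rewrite !Hper, !Hflat; lra. }
      destruct (Rle_or_lt y (2 * PI)); [now apply Hdec|].
      rewrite (Hz y) by lra.
      destruct (Rle_or_lt x (2 * PI)); [apply Hdec; lra|rewrite (Hz x); lra].
    + intros H1 H2 H3.
      generalize (Hr m Hm), (Hr (m - 1)%Z ltac:(lia)); intros H4 H5.
      enough (E : forall z, x <= z <= y -> f z = 0) by (rewrite !E; lra).
      intros z Hz; rewrite <- (periodic_Z f (- (q + 1)) z Hper), opp_IZR, plus_IZR.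
      apply Hflat; lra.
Qed.

(** * Suprema, moduli of smoothness and changes of monotonicity *)

Lemma real_Lub_Rbar_bounds (E : R -> Prop) M : (exists v, E v) ->
  (forall v, E v -> v <= M) ->
  (forall v, E v -> v <= real (Lub_Rbar E)) /\ real (Lub_Rbar E) <= M.
Proof.
  intros [v0 H0] HM; destruct (Lub_Rbar_correct E) as [Hub Hlub].
  assert (H1 : Rbar_le (Lub_Rbar E) M) by (apply Hlub; intros v Hv; simpl; auto).
  assert (H2 := Hub v0 H0).
  destruct (Lub_Rbar E) as [l| |]; simpl in *; try contradiction; split;
    [exact Hub|exact H1].
Qed.

Lemma real_Lub_Rbar_ge0 (E : R -> Prop) : (exists v, E v) ->
  (forall v, E v -> 0 <= v) -> 0 <= real (Lub_Rbar E).
Proof.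
  intros [v0 H0] HM; destruct (Lub_Rbar_correct E) as [Hub _].
  assert (H2 := Hub v0 H0).
  destruct (Lub_Rbar E) as [l| |]; simpl in *; try lra; generalize (HM v0 H0); lra.
Qed.

Lemma real_Glb_Rbar_ge (E : R -> Prop) M : (exists v, E v) ->
  (forall v, E v -> M <= v) -> M <= real (Glb_Rbar E).
Proof.
  intros [v0 H0] HM; destruct (Glb_Rbar_correct E) as [Hlb Hglb].
  assert (H1 : Rbar_le M (Glb_Rbar E)) by (apply Hglb; intros v Hv; simpl; auto).
  assert (H2 := Hlb v0 H0).
  destruct (Glb_Rbar E) as [l| |]; simpl in *; easy.
Qed.

Lemma supnorm_bounds g M : (forall x, Rabs (g x) <= M) ->
  (forall x, Rabs (g x) <= supnorm g) /\ supnorm g <= M.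
Proof.
  intros HM.
  destruct (real_Lub_Rbar_bounds (fun v => exists x, v = Rabs (g x)) M) as [H1 H2].
  - exists (Rabs (g 0)), 0; easy.
  - intros v [x ->]; auto.
  - split; auto; intros x; apply H1; now exists x.
Qed.

Lemma supnorm_ge0 g : 0 <= supnorm g.
Proof.
  apply real_Lub_Rbar_ge0.
  - exists (Rabs (g 0)), 0; easy.
  - intros v [x ->]; apply Rabs_pos.
Qed.

Lemma modulus_ge0 k g t : 0 < t -> 0 <= modulus k g t.
Proof.
  intros Ht; apply real_Lub_Rbar_ge0.
  - exists (supnorm (fdiff k t g)), t; split; auto; lra.
  - intros v [h [_ ->]]; apply supnorm_ge0.
Qed.

(** The smooth part contributes through its fourth derivative, the rest through
    its size times 1 + 4 + 6 + 4 + 1 = 16. *)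
Lemma modulus4_le g N p e M1 M2 t : 0 < t -> half_trig N p ->
  (forall x, g x = p x + e x) ->
  (forall x, Rabs (Derive_n p 4 x) <= M1) -> (forall x, Rabs (e x) <= M2) ->
  modulus 4 g t <= t ^ 4 * M1 + 16 * M2.
Proof.
  intros Ht Hp Hg H1 H2.
  assert (M1p : 0 <= M1) by (generalize (Rabs_pos (Derive_n p 4 0)), (H1 0); lra).
  apply real_Lub_Rbar_bounds.
  - exists (supnorm (fdiff 4 t g)), t; split; auto; lra.
  - intros v [h [Hh ->]]; apply supnorm_bounds; intros x.
    rewrite fdiff4_iter_diff.
    replace (iter_diff 4 h g x) with (iter_diff 4 h (fun y => p y + e y) x)
      by (simpl; now rewrite !Hg).
    rewrite iter_diff_plus; eapply Rle_trans; [apply Rabs_triang|].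
    apply Rplus_le_compat.
    + apply Rle_trans with (h ^ 4 * M1); [now apply (iter_diff_half_trig N)|].
      apply Rmult_le_compat_r; auto; apply pow_incr; lra.
    + replace 16 with (2 ^ 4) by ring; now apply iter_diff_bounded.
Qed.

Lemma trig_poly_lt_half_trig n T : trig_poly_lt n T -> half_trig (2 * n) T.
Proof.
  intros [m [a [b [Hm HT]]]].
  apply half_trig_ext with
    (fun x => sum_f_R0 (fun j => a j * cos (INR j * x) + b j * sin (INR j * x)) m);
    [|intros; now rewrite HT].
  clear HT; assert (Hj : forall j, (j <= m)%nat ->
    half_trig (2 * n) (fun x => a j * cos (INR j * x) + b j * sin (INR j * x))).
  { intros j Hj; apply half_trig_ext with (fun x =>
      a j * cos (INR (2 * j) * (x / 2) + 0) + b j * cos (INR (2 * j) * (x / 2) + - (PI / 2))).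
    - apply half_trig_lin; apply half_trig_cos; lia.
    - intros x; rewrite mult_INR; simpl (INR 2).
      replace ((1 + 1) * INR j * (x / 2)) with (INR j * x) by field.
      rewrite Rplus_0_r; f_equal; f_equal; apply cos_minus_PI2. }
  clear Hm; induction m as [|m IH]; simpl.
  - now apply Hj.
  - apply half_trig_plus; [apply IH; intros; apply Hj; lia|apply Hj; lia].
Qed.

(** At a point of change of monotonicity a comonotone function has a local
    extremum. *)
Lemma Delta1_derive_zero s Y N T i : collection s Y -> half_trig N T -> Delta1 Y T ->
  Derive T (Y i) = 0.
Proof.
  intros [Hlt _] HT [_ Hm].
  assert (L1 := Hlt (i - 1)%Z); replace (i - 1 + 1)%Z with i in L1 by ring.
  assert (L2 := Hlt i).
  set (e := powerRZ (-1) (i - 1)).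
  assert (He : powerRZ (-1) i = - e).
  { replace i with (i - 1 + 1)%Z at 1 by ring.
    rewrite powerRZ_add, powerRZ_1 by lra; unfold e; ring. }
  assert (He0 : e <> 0) by (apply powerRZ_NOR; lra).
  assert (D : derivable_pt_lim (fun x => e * T x) (Y i) (e * Derive T (Y i))).
  { apply is_derive_Reals, is_derive_scal.
    now apply half_trig_is_derive with N. }
  assert (E : e * Derive T (Y i) = 0).
  { rewrite <- (deriv_maximum (fun x => e * T x) (Y (i - 1)%Z) (Y (i + 1)%Z) (Y i)
      (exist _ _ D) L1 L2); [easy|].
    intros x H1 H2; destruct (Rle_or_lt x (Y i)).
    - apply Hm; lra.
    - generalize (Hm (i + 1)%Z (Y i) x); replace (i + 1 - 1)%Z with i by ring.
      rewrite He; intros H3; lra. }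
  destruct (Rmult_integral _ _ E); easy.
Qed.

Lemma cluster_near_0 s d m : (1 <= s)%nat -> (1 <= m < 2 * Z.of_nat s)%Z ->
  cluster s d (1 + (2 * Z.of_nat s * (-1) + m)) = d * (IZR m / IZR (2 * Z.of_nat s)).
Proof.
  intros Hs Hm; rewrite cluster_eq by lia; unfold cluster_point.
  destruct Z.eq_dec; [lia|ring].
Qed.

Lemma cluster_has_zeros s d g : (1 <= s)%nat -> 0 < d ->
  (forall i, g (cluster s d i) = 0) -> has_zeros (2 * s - 1) g 0 d.
Proof.
  intros Hs Hd Hg; assert (Hp : 0 < IZR (2 * Z.of_nat s)) by (apply IZR_lt; lia).
  enough (H : forall k, (k <= 2 * s - 1)%nat -> has_zeros k g
    (d * (IZR (2 * Z.of_nat s - 1 - Z.of_nat k) / IZR (2 * Z.of_nat s))) d).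
  { apply has_zeros_weaken with
      (d * (IZR (2 * Z.of_nat s - 1 - Z.of_nat (2 * s - 1)) / IZR (2 * Z.of_nat s)));
      [|now apply H].
    replace (2 * Z.of_nat s - 1 - Z.of_nat (2 * s - 1))%Z with 0%Z by lia.
    unfold Rdiv; rewrite Rmult_0_l; lra. }
  induction k as [|k IH]; intros Hk; [easy|].
  set (m := (2 * Z.of_nat s - 1 - Z.of_nat k)%Z) in *.
  exists (d * (IZR m / IZR (2 * Z.of_nat s))); split; [|split].
  - replace (2 * Z.of_nat s - 1 - Z.of_nat (S k))%Z with (m - 1)%Z by lia.
    generalize (cluster_ratio s m Hs ltac:(lia)); intros Hr; split; [|nra].
    apply Rmult_lt_compat_l; auto; apply Rmult_lt_compat_r;
      [now apply Rinv_0_lt_compat|apply IZR_lt; lia].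
  - rewrite <- (cluster_near_0 s d m Hs) by lia; apply Hg.
  - apply IH; lia.
Qed.

Lemma sin_cos_small y : 0 < y <= 1 / 8 ->
  y / 2 <= sin y <= y /\ 0.99 <= cos y <= 1.
Proof.
  intros Hy.
  assert (Hc : forall z, 0 < z <= 1 / 8 -> 0.99 <= cos z).
  { intros z Hz; replace z with (2 * (z / 2)) by field; rewrite cos_2a_sin.
    assert (sin (z / 2) < z / 2) by (apply sin_lt_x; lra).
    assert (0 <= sin (z / 2)) by (apply sin_ge_0; generalize PI2_3_2; lra).
    nra. }
  assert (Hs : sin y < y) by (apply sin_lt_x; lra).
  destruct (MVT_cor2 sin cos 0 y) as [c [Ec Hcy]]; [lra| |].
  { intros c _; apply derivable_pt_lim_sin. }
  rewrite sin_0, !Rminus_0_r in Ec.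
  generalize (Hc c ltac:(lra)), (Hc y Hy), (COS_bound y); intros; repeat split; try lra.
  rewrite Ec; nra.
Qed.

(** * The lower bound *)

(** The constant in the depth of the dip of the profile at x = b. *)
Definition dip (s : nat) : R := 2 / 5 * (1 / 4) ^ (2 * s + 1).

Lemma dip_pos s : 0 < dip s.
Proof. apply Rmult_lt_0_compat; [lra|apply pow_lt; lra]. Qed.

Lemma profile_dip s b : 0 < b <= 1 / 4 -> profile s b b <= - (dip s * b ^ (2 * s + 2)).
Proof.
  intros Hb; destruct (sin_cos_small (b / 2)) as [Hs Hc]; [lra|].
  unfold profile, dip.
  assert (Hc3 : 0.9 <= cos (b / 2) ^ 3).
  { apply Rle_trans with (0.99 ^ 3); [lra|apply pow_incr; lra]. }
  assert (Hp : (1 / 4 * b) ^ (2 * s + 1) <= sin (b / 2) ^ (2 * s + 1))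
    by (apply pow_incr; lra).
  assert (Hp0 : 0 <= (1 / 4 * b) ^ (2 * s + 1)) by (apply pow_le; lra).
  replace (2 / 5 * (1 / 4) ^ (2 * s + 1) * b ^ (2 * s + 2))
    with ((1 / 4 * b) ^ (2 * s + 1) * (2 / 5 * b)).
  - assert (sin (b / 2) - b * cos (b / 2) ^ 3 <= - (2 / 5 * b)) by nra.
    assert (0 <= 2 / 5 * b) by lra.
    nra.
  - rewrite Rpow_mult_distr; replace (2 * s + 2)%nat with (S (2 * s + 1)) by lia.
    simpl pow; ring.
Qed.

Lemma Derive_n_minus_half_trig N f g k x : half_trig N f -> half_trig N g ->
  Derive_n (fun y => f y - g y) k x = Derive_n f k x - Derive_n g k x.
Proof.
  intros Hf Hg; revert x; induction k as [|k IH]; intros x; [easy|].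
  change (Derive (Derive_n (fun y => f y - g y) k) x
          = Derive_n f (S k) x - Derive_n g (S k) x).
  rewrite (Derive_ext _ _ _ IH); apply is_derive_unique.
  apply (is_derive_minus (Derive_n f k) (Derive_n g k));
    now apply half_trig_is_derive_n with N.
Qed.

(** Let T be a comonotone polynomial and h = T - profile.  Bernstein's inequality
    bounds h^(2s).  The derivatives T', ..., T^(2s-1) have zeros in (0, d], where
    the derivatives of the profile are O(d); descending from h^(2s) to h, the
    increment of h on [0, b] is at most b^(2s) H up to terms in d, where H bounds
    h^(2s).  Since T increases from the cluster to b while the profile drops
    there by dip * b^(2s+2), this forces H to be at least of order b^2. *)
Section LowerBound.

Variables (s n : nat) (b d e0 K : R) (F T : R -> R).
Let D := (2 * INR s + 5) ^ (2 * s).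
Hypothesis Hs : (1 <= s)%nat.
Hypothesis Hn : (1 <= n)%nat.
Hypothesis Hb : 0 < b <= 1 / 4.
Hypothesis Hd : 0 < d <= b.
Hypothesis Hdsmall : 8 * D * d <= dip s * b ^ (2 * s + 2).
Hypothesis HF : forall x, Rabs (F x - profile s b x) <= e0.
Hypothesis HT : trig_poly_lt n T.
Hypothesis HTY : Delta1 (cluster s d) T.
Hypothesis HK : forall x, Rabs (F x - T x) <= K.

Let N := (2 * n + 2 * s + 4)%nat.
Let h := fun x => T x - profile s b x.

Lemma profile_derive_bound k x : (k <= 2 * s)%nat ->
  Rabs (Derive_n (profile s b) k x) <= 2 * D.
Proof.
  intros Hk; eapply Rle_trans.
  - apply (bernstein_n (2 * s + 4) _ 2); [apply half_trig_profile|].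
    intros y; apply profile_bound; lra.
  - rewrite Rmult_comm; apply Rmult_le_compat_l; [lra|].
    rewrite plus_INR, mult_INR; simpl (INR 2); simpl (INR 4).
    replace ((1 + 1) * INR s + (1 + 1 + 1 + 1) + 1) with (2 * INR s + 5) by ring.
    apply Rle_pow; auto; generalize (pos_INR s); lra.
Qed.

Lemma profile_derive_near_0 k z : (k < 2 * s)%nat -> 0 <= z <= d ->
  Rabs (Derive_n (profile s b) k z) <= 2 * D * d.
Proof.
  intros Hk Hz.
  assert (E0 : Derive_n (profile s b) k 0 = 0).
  { apply (Derive_n_sin_pow_0 3 (fun x => sin (x / 2) - b * cos (x / 2) ^ 3)
      (2 * s + 1) k); [|lia].
    apply half_trig_profile_factor. }
  rewrite <- (Rminus_0_r (Derive_n _ k z)), <- E0.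
  eapply Rle_trans.
  - apply lipschitz_of_derive_bound with (f' := Derive_n (profile s b) (S k)) (M := 2 * D).
    + intros t; apply half_trig_is_derive_n with (2 * s + 4)%nat, half_trig_profile.
    + intros t _; apply profile_derive_bound; lia.
  - rewrite Rminus_0_r, Rabs_pos_eq by lra.
    assert (0 < D) by (apply pow_lt; generalize (pos_INR s); lra); nra.
Qed.

Lemma half_trig_error : half_trig N h.
Proof.
  apply half_trig_minus.
  - apply half_trig_le with (2 * n)%nat; [lia|now apply trig_poly_lt_half_trig].
  - apply half_trig_le with (2 * s + 4)%nat; [lia|apply half_trig_profile].
Qed.

Let H := (INR N + 1) ^ (2 * s) * (K + e0).

Lemma error_derive_2s x : Rabs (Derive_n h (2 * s) x) <= H.
Proof.
  apply bernstein_n; [apply half_trig_error|]; intros y; unfold h.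
  replace (T y - profile s b y) with (- (F y - T y) + (F y - profile s b y)) by ring.
  eapply Rle_trans; [apply Rabs_triang|]; rewrite Rabs_Ropp.
  apply Rplus_le_compat; auto.
Qed.

Lemma error_derive_zero k : (1 <= k <= 2 * s - 1)%nat ->
  exists z, 0 < z <= d /\ Rabs (Derive_n h k z) <= 2 * D * d.
Proof.
  intros Hk; assert (HPI := PI2_3_2).
  assert (HTN := trig_poly_lt_half_trig n T HT).
  destruct (has_zeros_derive_n (2 * n) (Derive T) (2 * s - 1) (k - 1) 0 d)
    as [z [Hz Ez]]; [now apply half_trig_Derive|lia| |].
  { apply cluster_has_zeros; [auto|lra|]; intros i.
    apply Delta1_derive_zero with s (2 * n)%nat; auto.
    apply collection_cluster; auto; lra. }
  rewrite <- Derive_n_S_inner in Ez; replace (S (k - 1)) with k in Ez by lia.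
  exists z; split; auto; unfold h.
  rewrite (Derive_n_minus_half_trig N), Ez.
  - rewrite Rminus_0_l, Rabs_Ropp; apply profile_derive_near_0; [lia|lra].
  - apply half_trig_le with (2 * n)%nat; auto; lia.
  - apply half_trig_le with (2 * s + 4)%nat; [lia|apply half_trig_profile].
Qed.

(** One integration from a point of (0, d] costs a factor b; since b <= 1/4, the
    terms in d add up to a geometric series. *)
Lemma error_derive_bound i : (i <= 2 * s - 1)%nat -> forall x, 0 <= x <= b ->
  Rabs (Derive_n h (2 * s - i) x) <= 4 * D * d + b ^ i * H.
Proof.
  assert (D0 : 0 < D) by (apply pow_lt; generalize (pos_INR s); lra).
  assert (HH : 0 <= H) by (eapply Rle_trans; [apply Rabs_pos|apply (error_derive_2s 0)]).
  induction i as [|i IH]; intros Hi x Hx.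
  - replace (2 * s - 0)%nat with (2 * s)%nat by lia.
    generalize (error_derive_2s x); simpl; nra.
  - destruct (error_derive_zero (2 * s - S i)) as [z [Hz Ez]]; [lia|].
    replace (Derive_n h (2 * s - S i) x)
      with (Derive_n h (2 * s - S i) z
            + (Derive_n h (2 * s - S i) x - Derive_n h (2 * s - S i) z)) by ring.
    eapply Rle_trans; [apply Rabs_triang|].
    assert (L : Rabs (Derive_n h (2 * s - S i) x - Derive_n h (2 * s - S i) z)
                <= (4 * D * d + b ^ i * H) * Rabs (x - z)).
    { apply lipschitz_of_derive_bound with (Derive_n h (2 * s - i)).
      - intros t; replace (2 * s - i)%nat with (S (2 * s - S i)) by lia.
        apply half_trig_is_derive_n with N, half_trig_error.
      - intros t Ht; apply IH; [lia|].
        unfold Rmin, Rmax in Ht; destruct Rle_dec; lra. }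
    assert (Rabs (x - z) <= b) by (apply Rabs_le; lra).
    assert (0 <= b ^ i * H) by (apply Rmult_le_pos; auto; apply pow_le; lra).
    assert (0 <= 4 * D * d) by (repeat apply Rmult_le_pos; lra).
    assert ((4 * D * d + b ^ i * H) * Rabs (x - z) <= (4 * D * d + b ^ i * H) * b)
      by (apply Rmult_le_compat_l; lra).
    simpl pow; nra.
Qed.

Lemma comonotone_error_lower_bound :
  dip s * b ^ 2 <= 2 * (((2 * INR s + 7) * INR n) ^ (2 * s) * (K + e0)).
Proof.
  assert (D0 : 0 < D) by (apply pow_lt; generalize (pos_INR s); lra).
  assert (HH : 0 <= H) by (eapply Rle_trans; [apply Rabs_pos|apply (error_derive_2s 0)]).
  assert (HPI := PI2_3_2).
  set (t := d * (IZR (2 * Z.of_nat s - 1) / IZR (2 * Z.of_nat s))).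
  assert (Ht : 0 <= t <= d).
  { generalize (cluster_ratio s (2 * Z.of_nat s - 1) Hs ltac:(lia)); unfold t; nra. }
  assert (HTt : T t <= T b).
  { destruct HTY as [_ HM]; generalize (HM 1%Z t b).
    replace (1 - 1)%Z with (1 + (2 * Z.of_nat s * (-1) + (2 * Z.of_nat s - 1)))%Z at 1 by lia.
    rewrite cluster_near_0 by lia; fold t.
    replace 1%Z with (1 + (2 * Z.of_nat s * 0 + 0))%Z at 1 by lia.
    rewrite cluster_eq by lia; simpl powerRZ; unfold cluster_point; simpl Z.eq_dec; cbv iota.
    intros HM'; lra. }
  assert (Hh : Rabs (h b - h t) <= (4 * D * d + b ^ (2 * s - 1) * H) * Rabs (b - t)).
  { apply lipschitz_of_derive_bound with (Derive_n h 1).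
    - intros x; apply (half_trig_is_derive_n N h 0), half_trig_error.
    - intros x Hx; replace 1%nat with (2 * s - (2 * s - 1))%nat at 1 by lia.
      apply error_derive_bound; [lia|].
      unfold Rmin, Rmax in Hx; destruct Rle_dec; lra. }
  assert (HPt := profile_derive_near_0 0 t ltac:(lia) Ht); simpl in HPt.
  assert (HPb := profile_dip s b Hb).
  assert (Hbt : Rabs (b - t) <= b) by (apply Rabs_le; lra).
  assert (Hq : 0 <= b ^ (2 * s - 1) * H) by (apply Rmult_le_pos; auto; apply pow_le; lra).
  assert (Hq' : 0 <= 4 * D * d) by (repeat apply Rmult_le_pos; lra).
  assert (Hh' : Rabs (h b - h t) <= (4 * D * d + b ^ (2 * s - 1) * H) * b).
  { eapply Rle_trans; [exact Hh|]; apply Rmult_le_compat_l; lra. }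
  assert (Eb : b ^ (2 * s - 1) * H * b = b ^ (2 * s) * H).
  { replace (2 * s)%nat with (S (2 * s - 1)) at 2 by lia; simpl; ring. }
  apply Rabs_le_between in HPt; apply Rabs_le_between in Hh'; unfold h in Hh'.
  assert (Hkey : dip s * b ^ (2 * s + 2) <= 2 * (b ^ (2 * s) * H)) by nra.
  assert (Hbs : 0 < b ^ (2 * s)) by (apply pow_lt; lra).
  apply Rmult_le_reg_l with (b ^ (2 * s)); auto.
  apply Rle_trans with (2 * (b ^ (2 * s) * H)).
  - rewrite pow_add in Hkey; lra.
  - enough (H <= ((2 * INR s + 7) * INR n) ^ (2 * s) * (K + e0)) by nra.
    assert (Ke : 0 <= K + e0).
    { generalize (Rabs_pos (F 0 - T 0)), (HK 0), (Rabs_pos (F 0 - profile s b 0)), (HF 0).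
      lra. }
    apply Rmult_le_compat_r; auto; apply pow_incr; unfold N.
    rewrite !plus_INR, !mult_INR; simpl (INR 2); simpl (INR 4).
    assert (1 <= INR n) by (apply (le_INR 1); lia).
    assert (1 <= INR s) by (apply (le_INR 1); lia).
    split; [nra|nra].
Qed.

End LowerBound.

Lemma deriv_bounds_profile s b k : 0 <= b <= 1 ->
  deriv_bounds k (/ (2 * INR s + 5)) (profile s b) 2.
Proof.
  intros Hb; replace (2 * INR s + 5) with (INR (2 * s + 4) + 1).
  - apply deriv_bounds_half_trig; [apply half_trig_profile|].
    intros x; now apply profile_bound.
  - rewrite plus_INR, mult_INR; simpl; ring.
Qed.

Lemma Derive_n_plus_global f g k :
  (forall j x, (j <= k)%nat -> ex_derive_n f j x) ->
  (forall j x, (j <= k)%nat -> ex_derive_n g j x) ->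
  forall x, Derive_n (fun y => f y + g y) k x = Derive_n f k x + Derive_n g k x.
Proof.
  intros Hf Hg x; apply Derive_n_plus; apply filter_forall; intros y j Hj; auto.
Qed.

(** * The counterexample *)

Lemma flattened_estimates s r : r = (2 * s - 1)%nat -> (1 <= s)%nat ->
  exists C, 1 <= C /\ forall b, 0 < b <= 1 / 4 ->
    Crper r (flattened s b) /\
    (forall x, Rabs (flattened s b x - profile s b x) <= C * b ^ (2 * s + 2)) /\
    (forall t, 0 < t ->
      modulus 4 (Derive_n (flattened s b) r) t
      <= t ^ 4 * (2 * (2 * INR s + 5) ^ (r + 4)) + 16 * (C * b ^ 3)).
Proof.
  intros Hr Hs; destruct (deriv_bounds_patch s) as [C [HC HE]].
  exists (2 * C); split; [lra|]; intros b Hb.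
  set (E := fun x => patch s b 0 x + patch s b PI x).
  assert (HEb : deriv_bounds (2 * s) b E (2 * C * b ^ (2 * s + 2))).
  { replace (2 * C * b ^ (2 * s + 2))
      with (C * b ^ (2 * s + 2) + C * b ^ (2 * s + 2)) by ring.
    apply deriv_bounds_plus; apply HE; lra. }
  assert (HPb := deriv_bounds_profile s b (2 * s) ltac:(lra)).
  assert (Hsp := pos_INR s).
  assert (Hl : 0 < / (2 * INR s + 5)) by (apply Rinv_0_lt_compat; lra).
  assert (DE := deriv_bounds_Derive_n _ _ _ _ (proj1 Hb) HEb).
  assert (DP := deriv_bounds_Derive_n _ _ _ _ Hl HPb).
  assert (Hsum : forall k x, (k <= r)%nat -> Derive_n (flattened s b) k x
      = Derive_n (profile s b) k x + Derive_n E k x).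
  { intros k x Hk; apply (Derive_n_plus_global (profile s b) E).
    - intros j y Hj; apply DP; lia.
    - intros j y Hj; apply DE; lia. }
  assert (HFc : forall k x, (k <= r)%nat -> continuous (Derive_n (flattened s b) k) x).
  { intros k x Hk.
    apply continuous_ext with (fun x => Derive_n (profile s b) k x + Derive_n E k x).
    - intros y; symmetry; now apply Hsum.
    - apply (continuous_plus (V := R_NormedModule)); [apply DP|apply DE]; lia. }
  split; [|split].
  - split; [split|split].
    + intros x; apply (HFc 0%nat); lia.
    + apply flattened_periodic.
    + intros [|k] x Hk; [easy|]; simpl.
      apply (ex_derive_ext (fun x => Derive_n (profile s b) k x + Derive_n E k x)).
      * intros y; symmetry; apply Hsum; lia.
      * apply (ex_derive_plus (Derive_n (profile s b) k) (Derive_n E k)).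
        -- apply (DP (S k)); lia.
        -- apply (DE (S k)); lia.
    + intros x; apply HFc; lia.
  - intros x; unfold flattened; replace (_ + _ - _) with (E x) by (unfold E; ring).
    apply (deriv_bounds_abs _ _ _ _ x HEb).
  - intros t Ht; apply modulus4_le with (2 * s + 4)%nat (Derive_n (profile s b) r) (Derive_n E r);
      auto.
    + apply half_trig_Derive_n, half_trig_profile.
    + intros x; rewrite Derive_n_comp.
      assert (B := bernstein_n (2 * s + 4) (profile s b) 2 (4 + r) (half_trig_profile s b)
        (fun y => profile_bound s b y ltac:(lra)) x).
      eapply Rle_trans; [exact B|].
      rewrite Rmult_comm, (Nat.add_comm 4), plus_INR, mult_INR; right; f_equal.
      f_equal; simpl; ring.
    + intros x; eapply Rle_trans; [apply DE; lia|]; right.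
      replace (2 * s + 2)%nat with (3 + r)%nat by lia; rewrite pow_add; field.
      apply pow_nonzero; lra.
Qed.

Lemma Delta1_const Y c : Delta1 Y (fun _ => c).
Proof.
  split; [split|].
  - intros x; apply continuous_const.
  - easy.
  - intros; lra.
Qed.

(** The bound on F and the boundedness of trigonometric polynomials make
    [supnorm] a genuine supremum here. *)
Lemma En1_lower_bound n F Y m B : (1 <= n)%nat -> (forall x, Rabs (F x) <= B) ->
  (forall T K, trig_poly_lt n T -> Delta1 Y T -> (forall x, Rabs (F x - T x) <= K) -> m <= K) ->
  m <= En1 n F Y.
Proof.
  intros Hn HB Hm; apply real_Glb_Rbar_ge.
  - exists (supnorm (fun x => F x - 0)), (fun _ => 0); split; [|split]; auto.
    + exists 0%nat, (fun _ => 0), (fun _ => 0); split; [lia|].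
      intros x; simpl; ring.
    + apply Delta1_const.
  - intros v [T [HT [HY ->]]].
    destruct (half_trig_bounded _ _ (trig_poly_lt_half_trig n T HT)) as [A HA].
    apply (Hm T); auto.
    apply (supnorm_bounds _ (B + A)); intros x.
    eapply Rle_trans; [apply Rabs_triang|]; rewrite Rabs_Ropp.
    now apply Rplus_le_compat.
Qed.

Lemma flattened_Delta1 s b d : (1 <= s)%nat -> 0 < b <= 1 / 4 -> 0 < d <= b ->
  Cper (flattened s b) -> Delta1 (cluster s d) (flattened s b).
Proof.
  intros Hs Hb Hd Hc; assert (HPI := PI2_3_2).
  apply Delta1_cluster; auto; [lra| | |].
  - intros; apply flattened_increasing; auto.
  - intros; apply flattened_decreasing; auto.
  - intros x Hx; apply flattened_flat; [auto|lra|].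
    destruct (Req_dec x 0) as [->|Hx0].
    + replace (0 / 2) with 0 by field; rewrite sin_0; lra.
    + assert (sin (x / 2) < x / 2) by (apply sin_lt_x; lra); lra.
Qed.

(** The choice b = b0 / nu^4, nu being the cube root of n, balances the two
    contributions to the modulus of smoothness: t^4 = n^(-4) and b^3.  The lower
    bound for the error is then of order b^2 / n^(2s) = n^(-8/3 - 2s), larger by
    the factor nu than n^(-r) n^(-4). *)
Lemma counterexample s r : r = (2 * s - 1)%nat -> (1 <= s)%nat ->
  exists k C, 0 < k /\ 0 < C /\ forall (n : nat) (nu : R), (1 <= n)%nat -> 0 < nu ->
    nu ^ 3 = INR n ->
    exists Y F, collection s Y /\ Crper r F /\ Delta1 Y F /\
      k / (nu ^ 8 * INR n ^ (2 * s)) <= En1 n F Y /\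
      modulus 4 (Derive_n F r) (1 / INR n) <= C / INR n ^ 4.
Proof.
  intros Hr Hs; destruct (flattened_estimates s r Hr Hs) as [C [HC HF]].
  assert (HPI := PI2_3_2); assert (Hdip := dip_pos s).
  assert (Hs1 : 1 <= INR s) by (apply (le_INR 1); lia).
  set (G := (2 * INR s + 7) ^ (2 * s)).
  assert (HG : 1 <= G) by (apply pow_R1_Rle; lra).
  (* small enough for the flattening error to be absorbed by half of the dip *)
  set (b0 := Rmin (1 / 4) (dip s / (4 * G * C))).
  assert (HGC : 0 < 4 * G * C) by nra.
  assert (Hb0 : 0 < b0 <= 1 / 4).
  { split; [|apply Rmin_l]; apply Rmin_pos; [lra|].
    now apply Rdiv_lt_0_compat. }
  assert (Hb0' : b0 * (4 * G * C) <= dip s).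
  { apply Rle_trans with (dip s / (4 * G * C) * (4 * G * C)).
    - apply Rmult_le_compat_r; [lra|apply Rmin_r].
    - right; field; repeat split; lra. }
  exists (dip s * b0 ^ 2 / (4 * G)), (2 * (2 * INR s + 5) ^ (r + 4) + 16 * C * b0 ^ 3).
  split; [|split].
  { apply Rdiv_lt_0_compat; [|lra]; apply Rmult_lt_0_compat; auto; apply pow_lt; lra. }
  { assert (0 < (2 * INR s + 5) ^ (r + 4)) by (apply pow_lt; lra).
    assert (0 < b0 ^ 3) by (apply pow_lt; lra); nra. }
  intros n nu Hn Hnu Hnu3.
  assert (Hn1 : 1 <= INR n) by (apply (le_INR 1); lia).
  assert (Hnu1 : 1 <= nu).
  { destruct (Rle_or_lt 1 nu); auto.
    assert (nu ^ 3 < 1) by (simpl; nra); lra. }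
  set (b := b0 / nu ^ 4).
  assert (Hnu4 : 1 <= nu ^ 4) by (apply pow_R1_Rle; lra).
  assert (Hb : 0 < b <= 1 / 4).
  { split; [apply Rdiv_lt_0_compat; lra|].
    apply Rle_trans with (b0 / 1); [|lra].
    apply Rmult_le_compat_l; [lra|]; apply Rinv_le_contravar; lra. }
  set (D := (2 * INR s + 5) ^ (2 * s)).
  assert (HD : 0 < D) by (apply pow_lt; lra).
  (* makes the increments caused by d at most half of the depth of the dip *)
  set (d := Rmin b (dip s * b ^ (2 * s + 2) / (8 * D))).
  assert (Hbp : 0 < b ^ (2 * s + 2)) by (apply pow_lt; lra).
  assert (Hd : 0 < d <= b).
  { split; [|apply Rmin_l]; apply Rmin_pos; [lra|].
    apply Rdiv_lt_0_compat; nra. }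
  assert (Hd' : 8 * D * d <= dip s * b ^ (2 * s + 2)).
  { apply Rle_trans with (8 * D * (dip s * b ^ (2 * s + 2) / (8 * D))).
    - apply Rmult_le_compat_l; [lra|apply Rmin_r].
    - right; field; lra. }
  destruct (HF b Hb) as [HFr [HFP HFm]].
  exists (cluster s d), (flattened s b); split; [|split; [|split; [|split]]]; auto.
  - apply collection_cluster; auto; lra.
  - apply flattened_Delta1; auto; apply HFr.
  - apply En1_lower_bound with (2 + C * b ^ (2 * s + 2)); auto.
    { intros x; replace (flattened s b x)
        with (profile s b x + (flattened s b x - profile s b x)) by ring.
      eapply Rle_trans; [apply Rabs_triang|]; apply Rplus_le_compat; auto.
      apply profile_bound; lra. }
    intros T K HT HTY HK.
    assert (L := comonotone_error_lower_bound s n b d (C * b ^ (2 * s + 2)) K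
      (flattened s b) T Hs Hn Hb Hd Hd' HFP HT HTY HK).
    rewrite Rpow_mult_distr in L; fold G in L.
    assert (Hnb : INR n * b = b0 / nu).
    { unfold b; rewrite <- Hnu3; field; lra. }
    assert (Hnb0 : 0 < b0 / nu <= b0).
    { split; [apply Rdiv_lt_0_compat; lra|].
      apply Rle_trans with (b0 / 1); [|lra].
      apply Rmult_le_compat_l; [lra|]; apply Rinv_le_contravar; lra. }
    assert (Hnbp : (INR n * b) ^ (2 * s) <= b0).
    { rewrite Hnb; replace (2 * s)%nat with (S (2 * s - 1)) by lia.
      rewrite <- tech_pow_Rmult.
      assert ((b0 / nu) ^ (2 * s - 1) <= 1).
      { rewrite <- (pow1 (2 * s - 1)); apply pow_incr; lra. }
      apply Rle_trans with (b0 / nu * 1); [|lra].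
      apply Rmult_le_compat_l; lra. }
    assert (Hb2 : 0 < b ^ 2) by (apply pow_lt; lra).
    assert (Hnp : 0 < INR n ^ (2 * s)) by (apply pow_lt; lra).
    assert (Habs : 2 * (G * INR n ^ (2 * s) * (C * b ^ (2 * s + 2))) <= dip s * b ^ 2 / 2).
    { replace (2 * (G * INR n ^ (2 * s) * (C * b ^ (2 * s + 2))))
        with (2 * G * C * (INR n * b) ^ (2 * s) * b ^ 2)
        by (rewrite Rpow_mult_distr, pow_add; ring).
      apply Rle_trans with (2 * G * C * b0 * b ^ 2); [|nra].
      apply Rmult_le_compat_r; [lra|]; apply Rmult_le_compat_l; [nra|auto]. }
    assert (HKL : dip s * b ^ 2 <= 4 * (G * INR n ^ (2 * s) * K)) by lra.
    apply Rmult_le_reg_l with (4 * (G * INR n ^ (2 * s))); [nra|].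
    apply Rle_trans with (dip s * b ^ 2); [right|lra].
    unfold b; field; repeat split; lra.
  - eapply Rle_trans; [apply HFm|].
    + apply Rdiv_lt_0_compat; lra.
    + right; unfold b; rewrite <- Hnu3; field; lra.
Qed.

Lemma cube_root n : (1 <= n)%nat -> 0 < Rpower (INR n) (1 / 3) /\
  Rpower (INR n) (1 / 3) ^ 3 = INR n.
Proof.
  intros Hn; assert (0 < INR n) by (apply lt_0_INR; lia).
  split; [apply exp_pos|].
  rewrite <- Rpower_pow by apply exp_pos.
  rewrite Rpower_mult; simpl INR; replace (1 / 3 * (1 + 1 + 1)) with 1 by field.
  now apply Rpower_1.
Qed.

Theorem theorem2p5 (s r : nat) (hs : (1 <= s)%nat) (hr : r = (2 * s - 1)%nat) :
  (exists c : R, 0 < c /\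
    forall n : nat, (1 <= n)%nat ->
      exists (Y : Z -> R) (F : R -> R),
        collection s Y /\ Crper r F /\ Delta1 Y F /\
        En1 n F Y >
          Rpower (INR n) (1 / 3) * (c / INR n ^ r)
            * modulus 4 (Derive_n F r) (1 / INR n))
  /\
  (forall A N : R, 0 < A -> 0 < N ->
    exists (n : nat) (Y : Z -> R) (F : R -> R),
      INR n > N /\
      collection s Y /\ Crper r F /\ Delta1 Y F /\
      En1 n F Y > A / INR n ^ r * modulus 4 (Derive_n F r) (1 / INR n)).
Proof.
  match goal with |- ?P /\ _ => assert (H : P) end.
  - destruct (counterexample s r hr hs) as [k [C [Hk [HC H]]]].
    exists (k / (2 * C)); split; [apply Rdiv_lt_0_compat; lra|].
    intros n Hn; destruct (cube_root n Hn) as [Hnu Hnu3].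
    destruct (H n _ Hn Hnu Hnu3) as [Y [F [H1 [H2 [H3 [H4 H5]]]]]].
    exists Y, F; repeat split; try apply H1; try apply H2; try apply H3.
    set (nu := Rpower (INR n) (1 / 3)) in *.
    assert (Hn0 : 0 < INR n) by (apply lt_0_INR; lia).
    apply Rlt_gt, Rlt_le_trans with (k / (nu ^ 8 * INR n ^ (2 * s))); auto.
    assert (Hp : 0 < INR n ^ r) by now apply pow_lt.
    apply Rle_lt_trans with (nu * (k / (2 * C) / INR n ^ r) * (C / INR n ^ 4)).
    + apply Rmult_le_compat_l; auto.
      left; repeat apply Rmult_lt_0_compat; auto; apply Rinv_0_lt_compat; lra.
    + replace (2 * s)%nat with (S r) by lia.
      replace (nu * (k / (2 * C) / INR n ^ r) * (C / INR n ^ 4))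
        with (k / (nu ^ 8 * INR n ^ S r) / 2).
      * enough (0 < k / (nu ^ 8 * INR n ^ S r)) by lra.
        apply Rdiv_lt_0_compat; auto; apply Rmult_lt_0_compat; now apply pow_lt.
      * simpl (INR n ^ S r); set (q := INR n ^ r) in *; rewrite <- Hnu3; field.
        repeat split; lra.
  - split; [exact H|]; intros A N HA HN.
    destruct H as [c [Hc H]].
    destruct (nfloor_ex (N + (A / c) ^ 3 + 1)) as [n [_ Hn]].
    { assert (0 < (A / c) ^ 3) by (apply pow_lt, Rdiv_lt_0_compat; auto); lra. }
    assert (HAc : 0 < (A / c) ^ 3) by (apply pow_lt, Rdiv_lt_0_compat; auto).
    assert (Hn1 : (1 <= n)%nat) by (apply INR_lt; simpl; lra).
    destruct (H n Hn1) as [Y [F [H1 [H2 [H3 H4]]]]].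
    exists n, Y, F; repeat split; try apply H1; try apply H2; try apply H3; [lra|].
    apply Rgt_ge_trans with (1 := H4), Rle_ge.
    destruct (cube_root n Hn1) as [Hnu Hnu3].
    set (nu := Rpower (INR n) (1 / 3)) in *.
    assert (Hn0 : 0 < INR n) by (apply lt_0_INR; lia).
    apply Rmult_le_compat_r.
    + apply modulus_ge0, Rdiv_lt_0_compat; lra.
    + assert (HA' : A / c <= nu).
      { apply Rnot_lt_le; intros Hlt.
        assert (nu ^ 3 <= (A / c) ^ 3) by (apply pow_incr; lra); lra. }
      unfold Rdiv; rewrite <- Rmult_assoc; apply Rmult_le_compat_r.
      * left; apply Rinv_0_lt_compat, pow_lt; auto.
      * apply (Rmult_le_compat_r c) in HA'; [|lra].
        replace (A / c * c) with A in HA' by (field; lra); exact HA'.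
Qed.
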